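(* Let $\mathfrak g$ be a unimodular almost abelian real Lie algebra of real dimension $2n\ge 6$ endowed with a complex structure $J$. If $(\mathfrak g,J)$ admits an $(n-2)$-Kähler structure, then $(\mathfrak g,J)$ is Kähler, i.e. it admits a $1$-Kähler structure.
   Context: A Lie algebra is almost abelian if it has an abelian ideal of codimension one. It is unimodular if $\operatorname{tr}(\mathrm{ad}_X)=0$ for all $X$. A complex structure on a real Lie algebra $\mathfrak g$ is an endomorphism $J$ with $J^2=-\mathrm{Id}$ that is integrable (vanishing Nijenhuis tensor); $d$ denotes the Chevalley–Eilenberg differential. Positivity. Let $V$ be a complex vector space of dimension $n$ and $\Lambda^{p,q}$ the space of $(p,q)$-forms on $V$. An $(n,n)$-form $\nu$ is positive if $\nu=c\,i\alpha^1\wedge\overline{\alpha^1}\wedge\cdots\wedge i\alpha^n\wedge\overline{\alpha^n}$ with $c\in\mathbb R_{\ge0}$ and $\{\alpha^j\}$ a basis of $\Lambda^{1,0}$; it is a volume form if $c>0$. A $(q,0)$-form is simple if it is of the form $\mu_1\wedge\dots\wedge\mu_q$ with $\mu_j\in\Lambda^{1,0}$. A $(k,k)$-form $\Omega$ is transverse if for every non-zero simple $(n-k,0)$-form $\psi$ the $(n,n)$-form $i^{(n-k)^2}\,\Omega\wedge\psi\wedge\bar\psi$ is a volume form. A $p$-Kähler structure on a Lie algebra with complex structure $(\mathfrak g,J)$ of complex dimension $n$ ($1\le p<n$) is a real transverse $(p,p)$-form $\Omega$ on $(\mathfrak g,J)$ (a complex vector space via $J$) with $d\Omega=0$. For $p=1$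 this is the fundamental form of a Kähler metric on $(\mathfrak g,J)$, i.e. of a $J$-Hermitian inner product whose fundamental form is closed. *)

(* Defs.v *)
From mathcomp Require Import all_boot all_order all_algebra all_fingroup.
From mathcomp Require Import complex.
From mathcomp Require Import reals.

Set Implicit Arguments.
Unset Strict Implicit.
Unset Printing Implicit Defensive.

Import Order.TTheory GRing.Theory Num.Theory.
Local Open Scope ring_scope.

Record lie_algebra (R : realType) (g : vectType R) := LieAlgebra {
  lie_bracket :> {bilinear g -> g -> g};
  lie_alternating : forall x, lie_bracket x x = 0;
  lie_jacobi : forall x y z,
    lie_bracket x (lie_bracket y z) + lie_bracket y (lie_bracket z x)
      + lie_bracket z (lie_bracket x y) = 0
}.

Section LieAlgebra.
Context (R : realType) (g : vectType R) (L : lie_algebra g).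

Definition lie_ideal (h : {vspace g}) : Prop :=
  forall x u, u \in h -> L x u \in h.

Definition lie_abelian (h : {vspace g}) : Prop :=
  forall u v, u \in h -> v \in h -> L u v = 0.

Definition almost_abelian : Prop :=
  exists h : {vspace g},
    [/\ (\dim h).+1 = \dim {:g}, lie_ideal h & lie_abelian h].

Definition ad (x : g) : 'End(g) := linfun (L x).

Definition lie_trace (f : 'End(g)) : R :=
  \tr (passmx.mxof (vbasis {:g}) (vbasis {:g}) f).

Definition unimodular : Prop := forall x, lie_trace (ad x) = 0.

Definition nijenhuis (J : 'End(g)) (x y : g) : g :=
  L (J x) (J y) - J (L (J x) y) - J (L x (J y)) - L x y.

Definition complex_structure (J : 'End(g)) : Prop :=
  (forall x, J (J x) = - x) /\ (forall x y, nijenhuis J x y = 0).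

End LieAlgebra.

Section Forms.
Context (R : realType) (g : vectType R).
Local Notation C := R[i].

(* Carrier for complex-valued exterior k-forms on g, seen as functions of k
   vectors.  Multilinearity and alternation are not built in: every form below
   is obtained from linear functionals by wedge products and linear
   combinations, see [pq_form] and [simple_form]. *)
Definition kform (k : nat) : Type := ('I_k -> g) -> C.

Definition conj_form k (w : kform k) : kform k := fun x => (w x)^*%C.

Definition scale_form k (c : C) (w : kform k) : kform k := fun x => c * w x.

(* Normalised so that (a_1 /\ ... /\ a_k)(x_1, ..., x_k) = det (a_i (x_j))
   for 1-forms a_i. *)
Definition wedge k l (w : kform k) (t : kform l) : kform (k + l) := fun x =>
  (k`! * l`!)%:R^-1 *
    \sum_(s : 'S_(k + l)) (-1) ^+ s * w (fun i => x (s (lshift l i)))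
                                    * t (fun j => x (s (rshift k j))).

Definition form1 (a : g -> C) : kform 1 := fun x => a (x ord0).

Fixpoint wedges q : ('I_q -> g -> C) -> kform q :=
  match q with
  | 0 => fun _ _ => 1
  | q'.+1 => fun a =>
      wedge (form1 (a ord0)) (wedges (fun j => a (lift ord0 j)))
  end.

Variable J : 'End(g).

(* The complex vector space is g with i acting as J, so that (1,0)-forms are
   the C-linear functionals. *)
Definition form10 (a : g -> C) : Prop :=
  (forall (r : R) u v, a (r *: u + v) = r%:C%C * a u + a v) /\
  (forall u, a (J u) = 'i%C * a u).

Definition pq_form p q (w : kform (p + q)) : Prop :=
  exists (m : nat) (c : 'I_m -> C)
         (a : 'I_m -> 'I_p -> g -> C) (b : 'I_m -> 'I_q -> g -> C),
    [/\ forall t i, form10 (a t i),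
        forall t j, form10 (b t j) &
        forall x, w x = \sum_t c t *
          wedge (wedges (a t)) (wedges (fun j u => (b t j u)^*%C)) x].

Definition simple_form q (w : kform q) : Prop :=
  exists mu : 'I_q -> g -> C,
    (forall j, form10 (mu j)) /\ (forall x, w x = wedges mu x).

Definition basis10 n (a : 'I_n -> g -> C) : Prop :=
  (forall j, form10 (a j)) /\
  (forall b, form10 b ->
     exists! c : 'rV[C]_n, forall u, b u = \sum_j c 0 j * a j u).

(* i a_1 /\ conj a_1 /\ ... /\ i a_n /\ conj a_n *)
Fixpoint std_volume n : ('I_n -> g -> C) -> kform n.*2 :=
  match n with
  | 0 => fun _ _ => 1
  | n'.+1 => fun a =>
      wedge (wedge (scale_form 'i%C (form1 (a ord0)))
                   (conj_form (form1 (a ord0))))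
            (std_volume (fun j => a (lift ord0 j)))
  end.

(* The degree m is left free, and is forced to equal 2n, because the degree of
   a wedge product is 2n only up to a provable equation. *)
Definition volume_form (n m : nat) (nu : kform m) : Prop :=
  exists (c : R) (a : 'I_n -> g -> C) (e : n.*2 = m),
    [/\ 0 < c, basis10 a &
        forall x, nu x = c%:C%C * std_volume a (fun i => x (cast_ord e i))].

Definition transverse (n k : nat) (w : kform (k + k)) : Prop :=
  forall psi : kform (n - k),
    simple_form psi -> (exists x, psi x != 0) ->
    volume_form n
      (scale_form ('i%C ^+ ((n - k) ^ 2)%N)
         (wedge (wedge w psi) (conj_form psi))).

Definition real_form k (w : kform k) : Prop := forall x, conj_form w x = w x.

Variable L : lie_algebra g.

(* Chevalley-Eilenberg differential:
   (dw)(x_0, ..., x_k) = \sum_(i < j) (-1)^(i + j)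
                           w([x_i, x_j], x_0, .., ^x_i, .., ^x_j, .., x_k). *)
Definition ce_diff k (w : kform k) : kform k.+1 := fun x =>
  \sum_(i < k.+1) \sum_(j < k.+1 | (i < j)%N)
    (-1) ^+ (i + j) *
      w (fun l : 'I_k =>
           nth 0 (L (x i) (x j) ::
                  [seq x m | m <- enum 'I_k.+1 & (m != i) && (m != j)]) l).

Definition p_kahler (n p : nat) (w : kform (p + p)) : Prop :=
  [/\ (1 <= p < n)%N, pq_form w, real_form w, transverse n w &
      forall x, ce_diff w x = 0].

End Forms.

Arguments p_kahler {R g} J L n p w.

(* Main.v *)
Require Import Defs.
From mathcomp Require Import all_boot all_order all_algebra all_fingroup ring.
From mathcomp Require Import complex.
From mathcomp Require Import reals.

Set Implicit Arguments.
Unset Strict Implicit.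
Unset Printing Implicit Defensive.

Import Order.TTheory GRing.Theory Num.Theory.
Local Open Scope ring_scope.

(** Write h for the abelian ideal of codimension one, choose a linear functional
    xi with kernel h and a vector X with xi X = 1 and xi (J X) = 0, and put
    eta = - xi o J, alpha = xi + i eta.  The bracket is determined by ad X, since
    [u, v] = xi u [X, v] - xi v [X, u].  Integrability says that ad X commutes
    with J on the maximal complex subspace of h, so that, up to multiples of
    eta, ad X acts complex-linearly on the (1,0)-forms vanishing at X; and
    eta o ad X = a eta for a real number a ([reduced_ad], [eta_ad]).

    A (p,p)-form Omega with p = n - 2 is closed if and only if its restriction
    to h is invariant under ad X ([closed_invariant] is the direction used).
    Since ad X has trace zero, the trilinear functional

      T(f1, f2, f3) = (Omega /\ f1 /\ f2 /\ f3 /\ xi)(frame)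

    is then annihilated by the derivation induced by ad X
    ([top_pairing_invariant]).  Transversality of Omega against alpha /\ gamma
    says that H(gamma, delta) = T(gamma, conj delta, eta) is, up to a constant
    factor, a positive definite Hermitian form on the (1,0)-forms gamma that
    vanish at X ([top_pairing_positive]), and invariance of T says that ad X is
    skew for H up to the scalar -a ([top_pairing_skew]).  The spectral theorem
    therefore gives an H-orthogonal basis gamma_1, ..., gamma_(n-1) of
    eigenforms whose eigenvalues satisfy d_i + conj d_i = - a
    ([diagonal_frame]).

    The trace of ad X is a + sum_i (d_i + conj d_i) = a - (n - 1) a.  It vanishes
    and n >= 3, hence a = 0 and all d_i are imaginary ([weight0]).  If d_i = 0,
    invariance of T on (gamma_i, gamma_j, conj gamma_j) with j <> i forces
    gamma_i [X, J X] = 0, because T(gamma_i, gamma_j, eta) = 0 by bidegree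
    ([gam_kernel]).  This is the only obstruction to adding multiples of alpha
    to the gamma_i so that

      gamma_i [u, v] = d_i (xi u * gamma_i v - xi v * gamma_i u).

    For imaginary d_i these relations make
    i (alpha /\ conj alpha + sum_i gamma_i /\ conj gamma_i) closed, and it is a
    positive (1,1)-form ([kahler_of_diagonal_basis]).

    Forms are handled through determinants: a product f_1 /\ ... /\ f_m of
    functionals at points x_1, ..., x_m is det (f_i (x_j)), and wedging
    concatenates the lists of functionals ([wedge_fdet]).  All identities
    between top-degree forms become row and column operations. *)

(** * Lists indexed by ordinals *)

Section CodomOrd.
Variable T : Type.

Lemma codomS n (a : 'I_n.+1 -> T) :
  codom a = a ord0 :: codom (fun j => a (lift ord0 j)).
Proof. by rewrite /codom /image_mem enum_ordSl /= -map_comp. Qed.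

Lemma size_codom_ord n (a : 'I_n -> T) : size (codom a) = n.
Proof. by rewrite size_codom card_ord. Qed.

Lemma nth_codom_ord n (a : 'I_n -> T) x0 (i : 'I_n) : nth x0 (codom a) i = a i.
Proof. by rewrite /codom /image_mem (nth_map i) ?size_enum_ord // nth_ord_enum. Qed.

Lemma nth_map_codom (T' : Type) (F : T -> T') n (a : 'I_n -> T) x0 (i : 'I_n) :
  nth x0 (map F (codom a)) i = F (a i).
Proof. by rewrite (nth_map (a i)) ?nth_codom_ord // size_codom_ord. Qed.

Definition pair_fun (x y : T) : 'I_2 -> T := fun i => if i == ord0 then x else y.

Lemma codom_pair_fun x y : codom (pair_fun x y) = [:: x; y].
Proof. by rewrite !codomS /codom /image_mem enum_ord0. Qed.

Lemma set_nth_catl (x0 y : T) s t i : (i < size s)%N ->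
  set_nth x0 (s ++ t) i y = set_nth x0 s i y ++ t.
Proof. by elim: s i => [|x s IH] [|i] //= lt_is; rewrite IH. Qed.

Lemma set_nth_catr (x0 y : T) s t i :
  set_nth x0 (s ++ t) (size s + i) y = s ++ set_nth x0 t i y.
Proof. by elim: s => //= x s ->. Qed.

End CodomOrd.

Lemma enum_ord_neq k (j : 'I_k.+1) :
  [seq i <- enum 'I_k.+1 | i != j] = [seq lift j l | l <- enum 'I_k].
Proof.
apply: (inj_map val_inj); apply: (irr_sorted_eq ltn_trans ltnn).
- rewrite sorted_map; apply: sorted_filter; first by move=> a b c; apply: ltn_trans.
  by have := iota_ltn_sorted 0 k.+1; rewrite -val_enum_ord sorted_map.
- rewrite -map_comp (map_comp (bump j) val) val_enum_ord.
  have bump_mono : {homo bump j : a b / (a < b)%N} by move=> a b; rewrite !ltnNge leq_bump2.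
  exact: (homo_sorted bump_mono _ (iota_ltn_sorted 0 k)).
move=> x; apply/mapP/mapP; case=> i.
  rewrite mem_filter eq_sym => /andP[/unlift_some[l -> _] _] ->.
  by exists (lift j l) => //; rewrite map_f // mem_enum.
case/mapP=> l _ -> ->; exists (lift j l) => //.
by rewrite mem_filter eq_sym neq_lift mem_enum.
Qed.

(** * Determinants of families of functions *)

Section BlockPerm.
Variables k l : nat.

Definition block_perm (r : 'S_(k + l)) : bool :=
  [forall i : 'I_(k + l), (i < k)%N == (r i < k)%N].

(** The factor k! l! in the normalisation of the wedge product: these
    permutations form the internal direct product of the symmetric groups of
    the two blocks. *)
Lemma card_block_perm : #|[pred r | block_perm r]| = (k`! * l`!)%N.
Proof.
pose A := [set i : 'I_(k + l) | (i < k)%N].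
have cA : #|A| = k.
  rewrite -[RHS]card_ord -(card_imset _ (@lshift_inj k l)).
  apply: eq_card => i; rewrite inE; apply/idP/imsetP => [lt_ik|[j _ ->]].
    by exists (Ordinal lt_ik) => //; apply: val_inj.
  exact: (ltn_ord j).
have cCA : #|~: A| = l.
  by apply/eqP; rewrite -(eqn_add2l #|A|) cardsC card_ord cA.
have -> : #|[pred r | block_perm r]| = #|(Sym A * Sym (~: A))%g|.
  apply: eq_card => r; rewrite !inE; apply/forallP/mulsgP => [rA|].
    have nA : r \in ('N(A | 'P))%g.
      apply/astabsP => i /=; rewrite !inE apermE.
      by rewrite -(eqP (rA i)).
    pose u := restr_perm A r.
    exists u (u^-1 * r)%g; last by rewrite mulKVg.
      by rewrite inE restr_perm_on.
    rewrite inE; apply/subsetP => i; rewrite !inE; apply: contraNN => iA.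
    rewrite permM; apply/eqP; set j := u^-1%g i.
    have jA : j \in A.
      by rewrite -(perm_closed _ (restr_perm_on A r)) -/u /j permKV inE.
    by rewrite -(restr_permE nA jA) -/u /j permKV.
  case=> u v; rewrite !inE => uA vA -> i; rewrite permM.
  have := perm_closed i uA; have := perm_closed (u i) vA.
  by rewrite !inE -!leqNgt !(leqNgt k) => /negb_inj -> ->.
rewrite TI_cardMg ?card_Sym ?cA ?cCA //.
apply/trivgP/subsetP => s; rewrite !inE => /andP[sA sCA].
apply/eqP/permP => i; rewrite perm1.
case: (boolP (i \in A)) => iA; last exact: out_perm sA iA.
by apply: out_perm sCA _; rewrite inE iA.
Qed.

End BlockPerm.

Section Fdet.
Variables (F : comNzRingType) (T : Type).
Implicit Types (f : T -> F) (s t : seq (T -> F)).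

(** The default value is zero, so a list that is too short gives a matrix
    with zero rows. *)
Definition fmx m s (x : 'I_m -> T) : 'M[F]_m :=
  \matrix_(i, j) nth (fun=> 0) s i (x j).
Definition fdet m s (x : 'I_m -> T) : F := \det (fmx s x).

(** Laplace expansion along the first k rows, written as a sum over all
    permutations of the columns: each (k,l)-shuffle is counted k! l! times. *)
Lemma fdet_cat k l s t (x : 'I_(k + l) -> T) : size s = k ->
  \sum_(r : 'S_(k + l)) (-1) ^+ r * fdet s (fun i : 'I_k => x (r (lshift l i)))
     * fdet t (fun i : 'I_l => x (r (rshift k i)))
  = (k`! * l`!)%:R * fdet (s ++ t) x.
Proof.
move=> sz_s; pose M := fmx (s ++ t) x.
  (* The product of the two minors is the determinant of M with permuted
     columns, masked by the block-diagonal pattern m. *)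
pose m (i j : 'I_(k + l)) : F := ((i < k)%N == (j < k)%N)%:R.
have E (r : 'S_(k + l)) : fdet s (fun i : 'I_k => x (r (lshift l i)))
     * fdet t (fun i : 'I_l => x (r (rshift k i)))
   = \sum_(u : 'S_(k + l)) (-1) ^+ u * \prod_i (m i (u i) * M i (r (u i))).
  rewrite /fdet -(det_ublock _ 0).
  transitivity (\det (\matrix_(i, j) (m i j * M i (r j)))); last first.
    by apply: eq_bigr => u _; under eq_bigr => i _ do rewrite mxE.
  congr (\det _).
  apply/matrixP => i j; case: (splitP i) => i' Ei; case: (splitP j) => j' Ej.
  - have -> : i = lshift l i' by apply: val_inj.
    have -> : j = lshift l j' by apply: val_inj.
    by rewrite block_mxEul !mxE /m /= !ltn_ord eqxx mul1r nth_cat sz_s ltn_ord.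
  - have -> : i = lshift l i' by apply: val_inj.
    have -> : j = rshift k j' by apply: val_inj.
    by rewrite block_mxEur !mxE /m /= !ltn_ord ltnNge leq_addr /= mul0r.
  - have -> : i = rshift k i' by apply: val_inj.
    have -> : j = lshift l j' by apply: val_inj.
    by rewrite block_mxEdl !mxE /m /= !ltn_ord ltnNge leq_addr /= mul0r.
  - have -> : i = rshift k i' by apply: val_inj.
    have -> : j = rshift k j' by apply: val_inj.
    rewrite block_mxEdr !mxE /m /= !(ltnNge _ k) !leq_addr /= mul1r.
    by rewrite nth_cat sz_s ltnNge leq_addr /= addKn.
under eq_bigr => r _ do rewrite -mulrA E mulr_sumr.
rewrite exchange_big /=.
transitivity (\sum_(u : 'S_(k + l)) (block_perm u)%:R * \det M); last first.
  rewrite -mulr_suml -natr_sum -card_block_perm; congr (_%:R * _).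
  by rewrite -sum1_card [RHS]big_mkcond; apply: eq_bigr => u _; rewrite inE; case: ifP.
(* For a fixed u, substituting r := u^-1 r turns the inner sum into \det M. *)
apply: eq_bigr => u _; rewrite (reindex_inj (mulgI u^-1%g)) /= mulr_sumr.
apply: eq_bigr => r _; rewrite odd_permM odd_permV signr_addb.
have -> : \prod_i (m i (u i) * M i ((u^-1 * r)%g (u i)))
    = (block_perm u)%:R * \prod_i M i (r i).
  rewrite big_split /=; congr (_ * _); last first.
    by apply: eq_bigr => i _; rewrite permM permK.
  case: (boolP (block_perm u)) => [/forallP uP|].
    by rewrite big1 // => i _; rewrite /m (eqP (uP i)) eqxx.
  case/forallPn => i; rewrite (bigD1 i) //= /m => /negbTE ->; exact: mul0r.
rewrite [X in X * _]mulrC -mulrA signrMK.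
by rewrite mulrCA.
Qed.

End Fdet.

Section RowRep.
Variables (F : comNzRingType) (m : nat).
Implicit Types M N : 'M[F]_m.

Definition replace_row M N i0 := \matrix_(i, j) (if i == i0 then N i j else M i j).
Definition replace_col M N j0 := \matrix_(i, j) (if j == j0 then N i j else M i j).

Lemma cofactor_replace_row M N i j : cofactor (replace_row M N i) i j = cofactor M i j.
Proof.
rewrite /cofactor; congr (_ * \det _).
by apply/matrixP => a b; rewrite !mxE eq_sym (negbTE (neq_lift _ _)).
Qed.

(** The trace of N times the adjugate of M is the derivative of the determinant
    at M in the direction N.  It can be computed row by row or column by
    column, which is how a derivation acting on the functionals is exchanged
    for one acting on the points. *)
Lemma sum_det_replace_row M N : \sum_i \det (replace_row M N i) = \tr (N *m \adj M).
Proof.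
rewrite /mxtrace; apply: eq_bigr => i _; rewrite mxE (expand_det_row _ i).
by apply: eq_bigr => j _; rewrite cofactor_replace_row !mxE eqxx.
Qed.

Lemma replace_col_tr M N j : replace_col M N j = (replace_row M^T N^T j)^T.
Proof. by apply/matrixP => a b; rewrite !mxE. Qed.

Lemma sum_det_replace_col M N : \sum_i \det (replace_col M N i) = \tr (N *m \adj M).
Proof.
under eq_bigr => i _ do rewrite replace_col_tr det_tr.
by rewrite sum_det_replace_row -trmx_adj -trmx_mul mxtrace_tr mxtrace_mulC.
Qed.

End RowRep.

Section FdetRows.
Variables (F : comNzRingType) (T : Type).
Implicit Types (f g h : T -> F) (s t : seq (T -> F)).

Lemma eq_fdet m s t (x y : 'I_m -> T) :
  (forall i j : 'I_m, nth (fun=> 0) s i (x j) = nth (fun=> 0) t i (y j)) ->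
  fdet s x = fdet t y.
Proof.
by move=> E; congr (\det _); apply/matrixP => i j; rewrite !mxE; apply: E.
Qed.

Lemma fdet_cast m m' (e : m = m') s (x : 'I_m' -> T) :
  fdet s (fun i => x (cast_ord e i)) = fdet s x.
Proof.
by case: m' / e in x *; apply: eq_fdet => i j; rewrite cast_ord_id.
Qed.

Lemma fdet_col0 m s (x : 'I_m -> T) (j : 'I_m) :
  (forall i : 'I_m, nth (fun=> 0 : F) s i (x j) = 0) -> fdet s x = 0.
Proof.
move=> s0; rewrite /fdet (expand_det_col _ j) big1 // => i _.
by rewrite mxE s0 mul0r.
Qed.

Lemma fdet_row0 m s (x : 'I_m -> T) (i : 'I_m) :
  (forall j : 'I_m, nth (fun=> 0 : F) s i (x j) = 0) -> fdet s x = 0.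
Proof.
move=> s0; rewrite /fdet (expand_det_row _ i) big1 // => j _.
by rewrite mxE s0 mul0r.
Qed.

Lemma fdet_lin m s t (x : 'I_m -> T) a b f g h : (size s < m)%N ->
  (forall u, h u = a * f u + b * g u) ->
  fdet (s ++ h :: t) x = a * fdet (s ++ f :: t) x + b * fdet (s ++ g :: t) x.
Proof.
move=> lt_sm E; apply: (determinant_multilinear (i0 := Ordinal lt_sm)).
- by apply/rowP => j; rewrite !mxE /= !nth_cat ltnn subnn /= E.
- apply/matrixP => i j; rewrite !mxE /= !nth_cat /bump.
  case: (ltnP i (size s)) => hi; first by rewrite /= add0n hi.
  by rewrite /= add1n ltnNge (leqW hi) /= subSn.
- apply/matrixP => i j; rewrite !mxE /= !nth_cat /bump.
  case: (ltnP i (size s)) => hi; first by rewrite /= add0n hi.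
  by rewrite /= add1n ltnNge (leqW hi) /= subSn.
Qed.

Lemma fdet_alt m s t r (x : 'I_m -> T) f : (size s + (size t).+1 < m)%N ->
  fdet (s ++ f :: t ++ f :: r) x = 0.
Proof.
move=> lt_m; have lt_sm : (size s < m)%N.
  by apply: leq_ltn_trans lt_m; rewrite leq_addr.
apply: (@determinant_alternate _ _ _ (Ordinal lt_sm) (Ordinal lt_m)).
  by rewrite -val_eqE /= -[X in X != _]addn0 eqn_add2l.
move=> j; rewrite !mxE /= !nth_cat ltnn subnn ltnNge leq_addr /=.
by rewrite addKn /= nth_cat ltnn subnn.
Qed.

Lemma fdet_swap m s t (x : 'I_m -> T) f g : ((size s).+1 < m)%N ->
  fdet (s ++ f :: g :: t) x = - fdet (s ++ g :: f :: t) x.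
Proof.
move=> lt_m; have lt_m1 := ltnW lt_m.
pose h u := 1 * f u + 1 * g u.
have lin1 k : fdet (s ++ h :: k :: t) x
    = fdet (s ++ f :: k :: t) x + fdet (s ++ g :: k :: t) x.
  by rewrite (@fdet_lin _ s (k :: t) x 1 1 f g h) // !mul1r.
have lin2 k : fdet (s ++ k :: h :: t) x
    = fdet (s ++ k :: f :: t) x + fdet (s ++ k :: g :: t) x.
  by rewrite -!(cat_rcons k) (@fdet_lin _ _ t x 1 1 f g h) ?size_rcons // !mul1r.
have alt k : fdet (s ++ k :: k :: t) x = 0.
  by apply: (@fdet_alt m s [::]); rewrite addn1.
have := alt h; rewrite lin1 !lin2 !alt add0r addr0 => /eqP.
by rewrite addr_eq0 => /eqP.
Qed.

Lemma fdet_rot m s t (x : 'I_m -> T) f : (size s < m)%N ->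
  fdet (s ++ f :: t) x = (-1) ^+ size s * fdet (f :: s ++ t) x.
Proof.
elim/last_ind: s t => [|s g IH] t; first by rewrite mul1r.
rewrite size_rcons => lt_m; rewrite cat_rcons fdet_swap // IH ?(ltnW lt_m) //.
by rewrite exprS mulN1r mulNr cat_rcons.
Qed.

Lemma fdet_mul m (S : 'M[F]_m) s t (x : 'I_m -> T) :
  (forall (i : 'I_m) u, nth (fun=> 0) s i u
     = \sum_(j < m) S i j * nth (fun=> 0) t j u) ->
  fdet s x = \det S * fdet t x.
Proof.
move=> E; rewrite /fdet -det_mulmx; congr (\det _); apply/matrixP => i j.
by rewrite !mxE E; apply: eq_bigr => l _; rewrite !mxE.
Qed.

(** The derivative of a determinant when each functional is varied in turn;
    [sum_fdet_replace_point] is its counterpart for the points. *)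
Lemma fdet_set_nth m s (h : nat -> T -> F) (x : 'I_m -> T) : size s = m ->
  \sum_(i < m) fdet (set_nth (fun=> 0) s i (h i)) x
  = \tr ((\matrix_(i, j) h i (x j)) *m \adj (fmx s x)).
Proof.
move=> sz_s; rewrite -sum_det_replace_row; apply: eq_bigr => i _.
congr (\det _); apply/matrixP => a b; rewrite !mxE nth_set_nth /=.
by rewrite -val_eqE; case: ifP => // /eqP ->.
Qed.

End FdetRows.

Lemma fdet_small_span (F : fieldType) (T : Type) m q (s t : seq (T -> F))
    (S : 'M[F]_(m, q)) (x : 'I_m -> T) : (q < m)%N ->
  (forall (i : 'I_m) u, nth (fun=> 0) s i u
     = \sum_(j < q) S i j * nth (fun=> 0) t j u) ->
  fdet s x = 0.
Proof.
move=> lt_qm E; have -> : fdet s x = \det (S *m \matrix_(j, l) nth (fun=> 0) t j (x l)).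
  congr (\det _); apply/matrixP => i j.
  by rewrite !mxE E; apply: eq_bigr => l _; rewrite !mxE.
set B := \matrix_(_, _) _; apply/eqP; rewrite -[_ == 0]negbK -unitfE.
apply/negP => U; have /mxrank_unit Sr : S *m B \in unitmx by [].
have := leq_trans (mxrankM_maxl S B) (rank_leq_col S).
by rewrite Sr leqNgt lt_qm.
Qed.

(** * Forms as determinants *)

Section FormsAsDeterminants.
Variables (R : realType) (g : vectType R).
Local Notation C := R[i].
Implicit Types (f h : g -> C) (s t : seq (g -> C)).

Definition conjf f : g -> C := fun u => (f u)^*%C.

Lemma eq_wedge k l (w w' : kform g k) (t t' : kform g l) x :
  (forall y, w y = w' y) -> (forall y, t y = t' y) ->
  wedge w t x = wedge w' t' x.
Proof.
by move=> Ew Et; congr (_ * _); apply: eq_bigr => r _; rewrite Ew Et.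
Qed.

Lemma wedgeZ k l (c d : C) (w w' : kform g k) (t t' : kform g l) x :
  (forall y, w y = c * w' y) -> (forall y, t y = d * t' y) ->
  wedge w t x = c * d * wedge w' t' x.
Proof.
move=> Ew Et; rewrite /wedge [RHS]mulrCA; congr (_ * _); rewrite mulr_sumr.
by apply: eq_bigr => r _; rewrite Ew Et [_ * (c * _)]mulrCA mulrACA.
Qed.

Lemma wedge_suml k l m (c : 'I_m -> C) (w : 'I_m -> kform g k) (t : kform g l) x :
  wedge (fun y => \sum_j c j * w j y) t x = \sum_j c j * wedge (w j) t x.
Proof.
rewrite /wedge; under [RHS]eq_bigr => j _ do rewrite mulrCA mulr_sumr.
rewrite -mulr_sumr exchange_big; congr (_ * _); apply: eq_bigr => r _ /=.
rewrite mulr_sumr mulr_suml; apply: eq_bigr => j _.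
by rewrite mulrCA -!mulrA.
Qed.

Lemma wedge_fdet k l s t (x : 'I_(k + l) -> g) : size s = k ->
  wedge (@fdet C g k s) (@fdet C g l t) x = fdet (s ++ t) x.
Proof.
move=> sz_s; rewrite /wedge fdet_cat // mulKf // pnatr_eq0 -lt0n.
by rewrite muln_gt0 !fact_gt0.
Qed.

Lemma wedges_fdet q (a : 'I_q -> g -> C) x : wedges a x = fdet (codom a) x.
Proof.
elim: q => [|q IH] in a x *; first by rewrite /fdet det_mx00.
rewrite codomS -[RHS]/(fdet ([:: a ord0] ++ _) x) -(@wedge_fdet 1 q) //.
apply: eq_wedge => y; last exact: IH.
by rewrite /form1 /fdet det_mx11 mxE.
Qed.

Lemma conj_fdet m s (x : 'I_m -> g) : (fdet s x)^*%C = fdet (map conjf s) x.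
Proof.
rewrite /fdet -(det_map_mx (@conjc R)); congr (\det _).
apply/matrixP => i j; rewrite !mxE; case: (ltnP i (size s)) => lt_is.
  by rewrite (nth_map (fun=> 0)).
by rewrite !nth_default ?size_map // -[RHS](rmorph0 (@conjc R)).
Qed.

Lemma fdet_move m s t (x : 'I_m -> g) f h : ((size s).+1 < m)%N ->
  fdet (f :: h :: s ++ t) x = (-1) ^+ size s * fdet (f :: s ++ h :: t) x.
Proof.
move=> lt_m; rewrite -[X in _ * fdet X _]/((f :: s) ++ h :: t) fdet_rot //.
rewrite (@fdet_swap _ _ _ [::]) ?(leq_trans _ lt_m) //.
by rewrite /= exprS mulN1r mulrA -signr_odd mulrN -expr2 sqrr_sign mulN1r.
Qed.

Lemma sqr_iC : ('i%C : C) ^+ 2 = -1.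
Proof. exact: sqr_i. Qed.

(** The sign in the recursion for the standard volume form: moving conj a_1 past
    a_2, ..., a_(n+1) costs (-1)^n, and (n+1)^2 = n^2 + 1 + 2n. *)
Lemma expCi_sqrS n : ('i%C : C) * 'i%C ^+ (n ^ 2) * (-1) ^+ n = 'i%C ^+ (n.+1 ^ 2).
Proof.
rewrite -sqr_iC -exprM -exprS -exprD; congr (_ ^+ _).
by rewrite -(addn1 n) sqrnD exp1n muln1 addn1.
Qed.

(** Sorting the factors i a_j /\ conj a_j into all a_j followed by all conj a_j
    produces the constant i^(n^2), the one that occurs in the definition of
    transversality. *)
Lemma std_volume_fdet n (a : 'I_n -> g -> C) x :
  std_volume a x = 'i%C ^+ (n ^ 2) * fdet (codom a ++ map conjf (codom a)) x.
Proof.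
elim: n => [|n IH] in a x *; first by rewrite expr0 mul1r /fdet det_mx00.
pose b j := a (lift ord0 j); set s := codom b.
have sz_s : size s = n by rewrite size_codom_ord.
have E : std_volume a x = 'i%C * 'i%C ^+ (n ^ 2) *
    fdet ([:: a ord0; conjf (a ord0)] ++ (s ++ map conjf s)) x.
  rewrite -(@wedge_fdet (1 + 1) n.*2) //; apply: wedgeZ => y; last exact: IH.
  rewrite -[[:: _; _]]/([:: a ord0] ++ [:: conjf (a ord0)]) -(@wedge_fdet 1 1) //.
  rewrite -['i%C in RHS]mulr1; apply: wedgeZ => z; rewrite /fdet det_mx11 mxE //.
  by rewrite mul1r.
rewrite E codomS -/b -/s /= fdet_move ?sz_s ?mulrA ?expCi_sqrS //.
by rewrite doubleS !ltnS -addnn leq_addr.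
Qed.

End FormsAsDeterminants.

Arguments conjf {R g} f u.

Section PqRows.
Variables (R : realType) (g : vectType R) (N p q : nat).
Variables (a : 'I_N -> 'I_p -> g -> R[i]) (b : 'I_N -> 'I_q -> g -> R[i]).

Definition pq_rows t := codom (a t) ++ map conjf (codom (b t)).

Lemma pq_rows_size t : size (pq_rows t) = (p + q)%N.
Proof. by rewrite size_cat size_map !size_codom_ord. Qed.

Lemma pq_form_fdet (c : 'I_N -> R[i]) y :
  \sum_t c t * wedge (wedges (a t)) (wedges (fun j u => (b t j u)^*%C)) y
  = \sum_t c t * fdet (pq_rows t) y.
Proof.
apply: eq_bigr => t _; rewrite -wedge_fdet ?size_codom_ord //.
congr (_ * _); apply: eq_wedge => z; rewrite wedges_fdet //.
by rewrite /codom /image_mem -map_comp.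
Qed.

End PqRows.

(** * Bases of (1,0)-forms *)

Section Bases.
Variables (R : realType) (g : vectType R) (J : 'End(g)).
Local Notation C := R[i].
Implicit Types (f h : g -> C) (s t : seq (g -> C)).

Lemma conjcM (x y : C) : (x * y)^*%C = x^*%C * y^*%C.
Proof. exact: (rmorphM (@conjc R)). Qed.

Lemma conjc_sum I (r : seq I) (P : pred I) (F : I -> C) :
  (\sum_(i <- r | P i) F i)^*%C = \sum_(i <- r | P i) (F i)^*%C.
Proof. exact: (rmorph_sum (@conjc R)). Qed.

Lemma conjc0E : (0 : C)^*%C = 0. Proof. exact: (rmorph0 (@conjc R)). Qed.

Lemma conjci : ('i%C : C)^*%C = - 'i%C.
Proof. by apply/eqP; rewrite eq_complex /= oppr0 !eqxx. Qed.

Lemma Ci_neq0 : ('i%C : C) != 0.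
Proof.
apply/eqP=> i0; have /eqP := sqr_iC R.
by rewrite i0 expr0n /= eq_sym oppr_eq0 oner_eq0.
Qed.

Definition rlin f := forall (r : R) u v, f (r *: u + v) = r%:C%C * f u + f v.

Lemma rlin0 f : rlin f -> f 0 = 0.
Proof.
move=> lf; have := lf 1 0 0; rewrite scale1r addr0 rmorph1 mul1r.
by move/(congr1 (fun z => z - f 0)); rewrite subrr addrK.
Qed.

Lemma rlinD f u v : rlin f -> f (u + v) = f u + f v.
Proof. by move=> lf; have := lf 1 u v; rewrite scale1r rmorph1 mul1r. Qed.

Lemma rlinZ f r u : rlin f -> f (r *: u) = r%:C%C * f u.
Proof. by move=> lf; have := lf r u 0; rewrite (rlin0 lf) !addr0. Qed.

Lemma rlinN f u : rlin f -> f (- u) = - f u.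
Proof. by move=> lf; rewrite -scaleN1r rlinZ // rmorphN1 mulN1r. Qed.

Lemma rlin_sum f I (r : seq I) (P : pred I) (F : I -> g) : rlin f ->
  f (\sum_(i <- r | P i) F i) = \sum_(i <- r | P i) f (F i).
Proof.
move=> lf; elim/big_rec2: _ => [|i y1 y2 _ <-]; first exact: rlin0.
exact: rlinD.
Qed.

Lemma rlin_conjf f : rlin f -> rlin (conjf f).
Proof.
by move=> lf r u v; rewrite /conjf lf rmorphD rmorphM; congr (_ * _ + _); exact: conjc_real.
Qed.

Lemma rlin_lincomb n (c : 'I_n -> C) (a : 'I_n -> g -> C) :
  (forall i, rlin (a i)) -> rlin (fun u => \sum_j c j * a j u).
Proof.
move=> la r u v; rewrite mulr_sumr -big_split; apply: eq_bigr => j _ /=.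
by rewrite la mulrDr mulrCA.
Qed.

Lemma form10_rlin f : form10 J f -> rlin f. Proof. by case. Qed.

Lemma form10_lincomb n (c : 'I_n -> C) (a : 'I_n -> g -> C) :
  (forall i, form10 J (a i)) -> form10 J (fun u => \sum_j c j * a j u).
Proof.
move=> fa; split=> [|u]; first by apply: rlin_lincomb => i; case: (fa i).
by rewrite mulr_sumr; apply: eq_bigr => j _; rewrite (fa j).2 mulrCA.
Qed.

Definition all_rlin s := forall j, rlin (nth (fun=> 0) s j).

Lemma pq_rows_rlin N p q (a : 'I_N -> 'I_p -> g -> C) (b : 'I_N -> 'I_q -> g -> C) :
  (forall l j, form10 J (a l j)) -> (forall l j, form10 J (b l j)) ->
  forall l, all_rlin (pq_rows a b l).
Proof.
move=> a10 b10 l j; rewrite nth_cat size_codom_ord.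
case: ltnP => [lt_jp|_].
  by rewrite -[j]/(val (Ordinal lt_jp)) nth_codom_ord; apply: form10_rlin (a10 _ _).
case: (ltnP (j - p) q) => lt_jq; last first.
  rewrite nth_default; first by move=> r u v; rewrite mulr0 addr0.
  by rewrite size_map size_codom_ord.
rewrite -[(j - p)%N]/(val (Ordinal lt_jq)) nth_map_codom; apply: rlin_conjf.
exact: form10_rlin (b10 _ _).
Qed.

Lemma basis10_free n (a : 'I_n -> g -> C) (c : 'rV[C]_n) : basis10 J a ->
  (forall u, \sum_j c 0 j * a j u = 0) -> c = 0.
Proof.
case=> fa ba c0; have [c1 [_ uc]] := ba _ (form10_lincomb (fun j => c 0 j) fa).
rewrite -(uc c) //; apply: uc => u.
by rewrite c0 big1 // => j _; rewrite mxE mul0r.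
Qed.

Lemma sum_mulmx n p q (S : 'M[C]_(p, q)) (U : 'M[C]_(q, n)) (a : 'I_n -> g -> C) i u :
  \sum_j (S *m U) i j * a j u = \sum_l S i l * \sum_j U l j * a j u.
Proof.
under eq_bigr => j _ do rewrite mxE mulr_suml.
rewrite exchange_big; apply: eq_bigr => l _; rewrite mulr_sumr.
by apply: eq_bigr => j _; rewrite mulrA.
Qed.

Lemma sum_1mx n (a : 'I_n -> g -> C) i u :
  \sum_j (1%:M : 'M[C]_n) i j * a j u = a i u.
Proof.
rewrite (bigD1 i) //= mxE eqxx mul1r big1 ?addr0 // => j /negbTE ji.
by rewrite mxE eq_sym ji mul0r.
Qed.

Lemma basis10_change n (a b : 'I_n -> g -> C) (S : 'M[C]_n) : S \in unitmx ->
  basis10 J a -> (forall i u, b i u = \sum_j S i j * a j u) -> basis10 J b.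
Proof.
move=> uS ba Eb; have [fa _] := ba; split=> [j|f ff].
  have [l1 l2] := form10_lincomb (fun l => S j l) fa.
  by split=> [r u v|u]; rewrite !Eb.
have [c [Ec uc]] := ba.2 f ff; exists (c *m invmx S); split.
  move=> u; rewrite Ec -{1}[c](mulmxKV uS) sum_mulmx.
  by apply: eq_bigr => l _; rewrite Eb.
move=> d Ed; rewrite (uc (d *m S)) ?mulmxK // => u; rewrite Ed sum_mulmx.
by apply: eq_bigr => l _; rewrite Eb.
Qed.

Lemma basis10_coord n q (a : 'I_n -> g -> C) (b : 'I_q -> g -> C) : basis10 J a ->
  (forall i, form10 J (b i)) ->
  exists S : 'M[C]_(q, n), forall i u, b i u = \sum_j S i j * a j u.
Proof.
move=> ba fb; have [c Pc] := fin_all_exists (fun i => ba.2 _ (fb i)).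
exists (\matrix_(i, j) c i 0 j) => i u; rewrite (Pc i).1.
by apply: eq_bigr => j _; rewrite mxE.
Qed.

Lemma basis10_trans n (a b : 'I_n -> g -> C) : basis10 J a -> basis10 J b ->
  exists2 S : 'M[C]_n, S \in unitmx & forall i u, b i u = \sum_j S i j * a j u.
Proof.
move=> ba bb; have [S ES] := basis10_coord ba bb.1.
have [U EU] := basis10_coord bb ba.1; exists S => //.
apply: (proj1 (@mulmx1_unit _ _ _ U _)); apply/eqP; rewrite -subr_eq0; apply/eqP.
apply/row_matrixP => i; rewrite row0; apply: (basis10_free bb) => u.
under eq_bigr => j _ do rewrite mxE !mxE mulrBl.
rewrite sumrB (eq_bigr (fun j => (S *m U) i j * b j u)); last by move=> j _; rewrite mxE.
rewrite [X in _ - X](eq_bigr (fun j => (1%:M : 'M[C]_n) i j * b j u)); last first.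
  by move=> j _; rewrite mxE.
rewrite sum_mulmx sum_1mx; apply/eqP; rewrite subr_eq0; apply/eqP.
by rewrite ES; apply: eq_bigr => l _; rewrite EU.
Qed.

(** A change of basis of (1,0)-forms multiplies the volume form by |det S|^2;
    hence all volume forms are positive multiples of each other. *)
Lemma fdet_conj_change n m (a b : 'I_n -> g -> C) (S : 'M[C]_n) (x : 'I_m -> g) :
  m = (n + n)%N -> (forall i u, b i u = \sum_j S i j * a j u) ->
  fdet (codom b ++ map conjf (codom b)) x
  = \det S * (\det S)^*%C * fdet (codom a ++ map conjf (codom a)) x.
Proof.
move=> e ES; case: _ / (esym e) in x *.
rewrite (fdet_mul (S := block_mx S 0 0 (map_mx (@conjc R) S))
  (t := codom a ++ map conjf (codom a))).
  by rewrite det_ublock det_map_mx.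
move=> i u; rewrite big_split_ord /= nth_cat size_codom_ord.
case: (splitP i) => i' Ei.
  have -> : i = lshift n i' by apply: val_inj.
  rewrite [X in _ + X]big1 => [|j _]; last by rewrite block_mxEur mxE mul0r.
  rewrite /= nth_codom_ord ES addr0; apply: eq_bigr => j _.
  by rewrite block_mxEul nth_cat size_codom_ord /= ltn_ord nth_codom_ord.
have -> : i = rshift n i' by apply: val_inj.
rewrite big1 => [|j _]; last by rewrite block_mxEdl mxE mul0r.
rewrite /= addKn add0r.
rewrite (nth_map (fun=> 0)) ?size_codom_ord // nth_codom_ord /conjf ES.
rewrite rmorph_sum; apply: eq_bigr => j _.
rewrite block_mxEdr mxE [LHS]conjcM nth_cat size_codom_ord /= ltnNge leq_addr /= addKn.
by rewrite (nth_map (fun=> 0)) ?size_codom_ord // nth_codom_ord.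
Qed.

(** The forms a_j and conj a_j are linearly independent over the complex
    numbers: J acts on the former by i and on the latter by -i, so a relation
    splits into one between the a_j and one between the conj a_j. *)
Lemma fdet_basis_neq0 n m (a : 'I_n -> g -> C) (e : 'I_m -> g) :
  m = (n + n)%N -> basis10 J a ->
  (forall u, exists r : 'I_m -> R, u = \sum_j r j *: e j) ->
  fdet (codom a ++ map conjf (codom a)) e != 0.
Proof.
move=> Em ba; case: _ / (esym Em) in e * => span_e.
apply/det0P => -[v v0 vM]; case/negP: v0.
pose c j := v 0 (lshift n j); pose d j := v 0 (rshift n j).
pose f1 u := \sum_j c j * a j u; pose f2 u := \sum_j d j * (a j u)^*%C.
have l1 : rlin f1 by apply: rlin_lincomb => i; exact: form10_rlin (ba.1 i).
have l2 : rlin f2.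
  apply: (@rlin_lincomb _ _ (fun i => conjf (a i))) => i.
  exact: rlin_conjf (form10_rlin (ba.1 i)).
have f12 u : f1 u + f2 u = 0.
  have [r ->] := span_e u; rewrite !rlin_sum // -big_split big1 // => j _ /=.
  rewrite !rlinZ // -mulrDr [X in _ * X](_ : _ = 0) ?mulr0 //.
  have /rowP/(_ j) := vM; rewrite !mxE big_split_ord /= => <-.
  congr (_ + _); apply: eq_bigr => i _; rewrite !mxE nth_cat size_codom_ord /=.
    by rewrite ltn_ord nth_codom_ord.
  rewrite ltnNge leq_addr /= addKn (nth_map (fun=> 0)) ?size_codom_ord //.
  by rewrite nth_codom_ord.
have J1 u : f1 (J u) = 'i%C * f1 u.
  rewrite /f1 mulr_sumr; apply: eq_bigr => j _.
  by rewrite (ba.1 j).2 mulrCA.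
have J2 u : f2 (J u) = - ('i%C * f2 u).
  rewrite /f2 mulr_sumr -sumrN; apply: eq_bigr => j _.
  by rewrite (ba.1 j).2 conjcM conjci mulNr mulrN mulrCA.
have f1m2 u : f1 u = f2 u.
  apply: (mulfI Ci_neq0); apply/eqP; rewrite -subr_eq0.
  by rewrite -J1 -J2 f12.
have f10 u : f1 u = 0.
  have := f12 u; rewrite -f1m2 -mulr2n -mulr_natl => /eqP.
  by rewrite mulf_eq0 pnatr_eq0 /= => /eqP.
have c0 : (\row_j c j) = 0.
  by apply: (basis10_free ba) => u; rewrite -[RHS](f10 u); apply: eq_bigr => j _; rewrite mxE.
have d0 : (\row_j (d j)^*%C) = 0.
  apply: (basis10_free ba) => u; apply: (can_inj (@conjcK R)).
  rewrite conjc_sum [RHS]conjc0E -[RHS](f10 u) f1m2 /f2; apply: eq_bigr => j _.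
  by rewrite mxE conjcM conjcK.
apply/eqP/rowP => j; rewrite mxE -[j]splitK.
case: (split j) => j' /=; first by move/rowP/(_ j'): c0; rewrite !mxE.
move/rowP/(_ j'): d0; rewrite !mxE => /eqP.
by rewrite conjc_eq0 => /eqP.
Qed.

End Bases.

(** * Diagonalisation of skew operators *)

Section Skew.
Local Open Scope sesquilinear_scope.
Variable C : numClosedFieldType.

Lemma trmxC_mul m n p (A : 'M[C]_(m, n)) (B : 'M[C]_(n, p)) :
  (A *m B)^t* = B^t* *m A^t*.
Proof. by rewrite trmx_mul map_mxM. Qed.

Lemma spectral_diag_row n (A : 'M[C]_n) i : A \is normalmx ->
  spectral_diag A 0 i = (row i (spectralmx A) *m A *m (row i (spectralmx A))^t*) 0 0.
Proof.
move=> nA; set U := spectralmx A; have uU : U \is unitarymx := spectral_unitarymx A.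
have E : U *m A *m U^t* = diag_mx (spectral_diag A).
  rewrite {1}(orthomx_spectralP nA) -/U !mulmxA mulmxV ?spectral_unit //.
  by rewrite mul1mx -mulmxA (unitarymxP uU) mulmx1.
have -> : spectral_diag A 0 i = (U *m A *m U^t*) i i by rewrite E mxE eqxx.
rewrite -row_mul !mxE; apply: eq_bigr => j _; rewrite !mxE; congr (_ * _).
Qed.

(** Polarisation: the defect K = H^* - H is skew-Hermitian, hence normal, and
    its eigenvalues are values of its quadratic form, which is zero. *)
Lemma pos_hermitian n (H : 'M[C]_n) :
  (forall c : 'rV_n, c != 0 -> 0 < (c *m H *m c^t*) 0 0) -> H^t* = H.
Proof.
move=> Hpos.
have Hreal (c : 'rV_n) : (c *m H^t* *m c^t*) 0 0 = (c *m H *m c^t*) 0 0.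
  have [->|/Hpos pos] := eqVneq c 0; first by rewrite !mul0mx.
  rewrite -[RHS](CrealP (gtr0_real pos)).
  transitivity ((c *m H *m c^t*)^t* 0 0); last by rewrite !mxE.
  by rewrite !trmxC_mul trmxCK mulmxA.
pose K := H^t* - H.
have KN : K^t* = - K by rewrite /K linearB /= map_mxB trmxCK opprB.
have nK : K \is normalmx by apply/normalmxP; rewrite KN mulmxN mulNmx.
suff k0 : spectral_diag K = 0.
  apply/eqP; rewrite -subr_eq0 -/K (orthomx_spectralP nK) k0 raddf0.
  by rewrite mulmx0 mul0mx.
apply/rowP => i; rewrite spectral_diag_row // mulmxBr mulmxBl.
by rewrite mxE [X in _ + X]mxE Hreal subrr mxE.
Qed.

(** In an H-orthonormal basis the condition reads N + N^* = a, so N^* commutes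
    with N and the spectral theorem applies. *)
Lemma skew_eigenbasis n (H P : 'M[C]_n) (a : C) :
  (forall c : 'rV_n, c != 0 -> 0 < (c *m H *m c^t*) 0 0) ->
  P *m H + H *m P^t* = a *: H ->
  exists S, exists d : 'rV[C]_n, [/\ S \in unitmx,
    S *m P = diag_mx d *m S & S *m H *m S^t* = 1%:M].
Proof.
move=> Hpos skewP; have Hherm := pos_hermitian Hpos.
have Hnormal : H \is normalmx by apply/normalmxP; rewrite Hherm.
pose U := spectralmx H; have Uu : U \is unitarymx := spectral_unitarymx H.
pose h := spectral_diag H.
have UH : U *m H *m U^t* = diag_mx h.
  rewrite {1}(orthomx_spectralP Hnormal) -/U -/h !mulmxA mulmxV ?spectral_unit //.
  by rewrite mul1mx -mulmxA (unitarymxP Uu) mulmx1.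
have hpos i : 0 < h 0 i.
  rewrite /h spectral_diag_row //; apply/Hpos/eqP => r0.
  have : U *m invmx U = 1%:M by rewrite mulmxV // spectral_unit.
  move/(congr1 (row i)); rewrite row_mul r0 mul0mx => /rowP/(_ i).
  by rewrite !mxE eqxx => /eqP; rewrite eq_sym oner_eq0.
pose r := \row_i (sqrtC (h 0 i))^-1; pose D := diag_mx r.
have r_neq0 i : r 0 i != 0 by rewrite mxE invr_eq0 sqrtC_eq0 gt_eqF.
have D_unit : D \in unitmx.
  by rewrite unitmxE det_diag unitfE; apply/prodf_neq0.
have Dadj : D^t* = D.
  apply/matrixP => i j; rewrite !mxE rmorphMn /= eq_sym.
  case: eqP => [->|_]; last by rewrite !mulr0n.
  by rewrite fmorphV /= geC0_conj ?sqrtC_ge0 ?ltW.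
(* The rows of S1 form an H-orthonormal basis. *)
pose S1 := D *m U.
have S1_unit : S1 \in unitmx by rewrite unitmx_mul D_unit spectral_unit.
have S1H : S1 *m H *m S1^t* = 1%:M.
  rewrite /S1 trmxC_mul Dadj !mulmxA -(mulmxA D) -(mulmxA D) UH.
  rewrite !mulmx_diag -diag_const_mx; congr diag_mx; apply/rowP => i.
  rewrite !mxE mulrAC -invfM -expr2 sqrtCK mulVf ?gt_eqF //.
clearbody S1; pose N := S1 *m P *m invmx S1.
have NE : N = S1 *m (P *m H) *m S1^t*.
  by rewrite -[N]mulmx1 -S1H /N !mulmxA mulmxKV.
have NS : N *m S1 = S1 *m P by rewrite mulmxKV.
clearbody N.
have NN : N^t* = a%:M - N.
  apply: (addrI N); rewrite [RHS]addrC subrK NE !trmxC_mul trmxCK Hherm.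
  rewrite !mulmxA -!(mulmxA S1) -mulmxDr -mulmxDl skewP.
  by rewrite -scalemxAl -scalemxAr mulmxA S1H scalemx1.
have nN : N \is normalmx.
  by apply/normalmxP; rewrite NN mulmxBr mulmxBl scalar_mxC.
pose V := spectralmx N; have Vu : V \is unitarymx := spectral_unitarymx N.
exists (V *m S1), (spectral_diag N); split.
- by rewrite unitmx_mul spectral_unit.
- rewrite -mulmxA -NS {1}(orthomx_spectralP nN) -/V !mulmxA.
  by rewrite mulmxV ?spectral_unit // mul1mx.
- rewrite trmxC_mul !mulmxA -(mulmxA V) -(mulmxA V) S1H mulmx1.
  exact/unitarymxP.
Qed.
End Skew.

(** * Kähler forms from eigenforms of the bracket *)

Lemma gt0_complex (R : realType) (z : R[i]) : 0 < z ->
  exists2 c : R, 0 < c & z = c%:C%C.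
Proof. by case: z => a b; rewrite ltcE /= => /andP[/eqP -> a0]; exists a. Qed.

Lemma det_col_mx_lin (F : comNzRingType) q (r : 'rV[F]_q.+1) (M : 'M[F]_(q, q.+1)) :
  \det (col_mx r M : 'M_(1 + q)) =
  \sum_j r 0 j * \det (col_mx (delta_mx 0 j) M : 'M_(1 + q)).
Proof.
have cof (r' : 'rV[F]_q.+1) j : cofactor (col_mx r' M : 'M_(1 + q)) ord0 j
    = cofactor (col_mx r M : 'M_(1 + q)) ord0 j.
  rewrite /cofactor; congr (_ * \det _); apply/matrixP => i l.
  by rewrite !mxE; case: splitP => // -[[|//] ? /=].
have row0E (r' : 'rV[F]_q.+1) j : (col_mx r' M : 'M_(1 + q)) ord0 j = r' 0 j.
  have -> : ord0 = lshift q (0 : 'I_1) by apply: val_inj.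
  by rewrite col_mxEu.
rewrite (expand_det_row _ ord0); apply: eq_bigr => j _.
rewrite row0E (expand_det_row _ ord0) (bigD1 j) //= row0E mxE !eqxx mul1r.
rewrite big1 ?addr0 ?cof // => l /negbTE lj.
by rewrite row0E mxE lj andbF mul0r.
Qed.

(** The maximal minors of a full-rank matrix do not all vanish. *)
Lemma exists_det_col_mx_neq0 (F : fieldType) q (M : 'M[F]_(q, q.+1)) :
  row_free M -> exists j, \det (col_mx (delta_mx 0 j) M : 'M_(1 + q)) != 0.
Proof.
move=> freeM; apply/existsP; apply: contraT; rewrite negb_exists => /forallP d0.
have det0 r : \det (col_mx r M : 'M_(1 + q)) = 0.
  rewrite det_col_mx_lin big1 // => j _.
  by move/(_ j): d0; rewrite negbK => /eqP ->; rewrite mulr0.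
have /row_subPn[i iM] : ~~ (1%:M <= M)%MS.
  apply/negP => /mxrankS; rewrite mxrank1.
  by rewrite leqNgt ltnS rank_leq_row.
set r := row i 1%:M in iM.
have := det0 r; move/eqP; rewrite -[_ == 0]negbK -unitfE -[_ \is a _]/(_ \in unitmx).
case/negP; rewrite -row_free_unit -row_leq_rank.
have := ltn_leqif (mxrank_leqif_sup (addsmxSr r M)); rewrite addsmx_sub submx_refl andbT iM.
rewrite addsmxE => lt_rk; apply: leq_trans lt_rk.
by rewrite (eqP freeM).
Qed.

Section FdetTwo.
Variables (F : comNzRingType) (T : Type).

Lemma fdet2 (f h : T -> F) (x : 'I_2 -> T) :
  fdet [:: f; h] x = f (x ord0) * h (x ord_max) - f (x ord_max) * h (x ord0).
Proof.
rewrite /fdet (expand_det_row _ ord0) !big_ord_recl big_ord0 addr0 /cofactor.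
rewrite !det_mx11 !mxE /= expr0 expr1 mul1r mulN1r mulrN.
by congr (f (x _) * h (x _) - f (x _) * h (x _)); apply: val_inj.
Qed.

End FdetTwo.

Lemma ce_diff2 (R : realType) (g : vectType R) (L : lie_algebra g) (w : kform g 2)
    (W : g -> g -> R[i]) x :
  (forall y, w y = W (y ord0) (y ord_max)) ->
  let x0 := x ord0 in let x1 := x (lift ord0 ord0) in let x2 := x ord_max in
  ce_diff L w x = - W (L x0 x1) x2 + W (L x0 x2) x1 - W (L x1 x2) x0.
Proof.
move=> wE /=; rewrite /ce_diff.
under eq_bigr => i _ do under eq_bigr => j _ do rewrite wE !enum_ordSl enum_ord0.
under eq_bigr => i _ do rewrite big_mkcond /= !big_ord_recl big_ord0.
rewrite !big_ord_recl big_ord0 /=.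
have -> : lift ord0 (lift ord0 ord0) = ord_max :> 'I_3 by apply: val_inj.
rewrite -[(-1) ^+ (0 + bump 0 0)]signr_odd -[(-1) ^+ (0 + bump _ _)]signr_odd.
rewrite -[(-1) ^+ (bump _ _ + bump _ _)]signr_odd /= expr0 expr1.
by rewrite !(addr0, add0r, mulN1r, mul1r).
Qed.

(** The Chevalley-Eilenberg differential of i a /\ conj a, where a [u, v] =
    l (k u * a v - k v * a u) with l imaginary, so that -l replaces l in the
    conjugate. *)
Lemma kahler_cocycle (F : comNzRingType) (i l k0 k1 k2 a0 a1 a2 b0 b1 b2 : F) :
  - (i * (l * (k0 * a1 - k1 * a0) * b2 - a2 * (- l * (k0 * b1 - k1 * b0))))
  + i * (l * (k0 * a2 - k2 * a0) * b1 - a1 * (- l * (k0 * b2 - k2 * b0)))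
  - i * (l * (k1 * a2 - k2 * a1) * b0 - a0 * (- l * (k1 * b2 - k2 * b1))) = 0.
Proof. ring. Qed.

Section KahlerForm.
Variables (R : realType) (g : vectType R) (L : lie_algebra g) (J : 'End(g)).
Local Notation C := R[i].

Definition kahler_form n (a : 'I_n -> g -> C) : kform g (1 + 1) := fun x =>
  \sum_j 'i%C * wedge (wedges (fun _ : 'I_1 => a j))
                      (wedges (fun (_ : 'I_1) u => (a j u)^*%C)) x.

Lemma codom1 (f : g -> C) : codom (fun _ : 'I_1 => f) = [:: f].
Proof. by rewrite codomS /codom /image_mem enum_ord0. Qed.

Lemma kahler_form_fdet n (a : 'I_n -> g -> C) x :
  kahler_form a x = \sum_j 'i%C * fdet [:: a j; conjf (a j)] x.
Proof.
apply: eq_bigr => j _; congr (_ * _).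
rewrite -(@wedge_fdet _ _ 1 1 [:: a j] [:: conjf (a j)]) //.
by apply: eq_wedge => y; rewrite wedges_fdet codom1.
Qed.

Lemma kahler_form_real n (a : 'I_n -> g -> C) : real_form (kahler_form a).
Proof.
move=> x; rewrite /conj_form !kahler_form_fdet conjc_sum; apply: eq_bigr => j _.
rewrite conjcM conjci conj_fdet /= (@fdet_swap _ _ _ [::] [::]) //= mulrNN.
by congr (_ * _); apply: eq_fdet => -[[|[|]] ?] //= l; rewrite /conjf conjcK.
Qed.

(** Wedging a_j /\ conj a_j with psi /\ conj psi gives |det S_j|^2 times the
    standard volume form, where S_j has rows a_j and the factors of psi in the
    basis a.  The sum over j is positive since the factors of psi are
    independent. *)
Lemma kahler_form_transverse n q (a : 'I_n -> g -> C) (psi : kform g q) :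
  n = q.+1 -> basis10 J a -> simple_form J psi -> (exists x, psi x != 0) ->
  volume_form J n (scale_form ('i%C ^+ (q ^ 2)%N)
    (wedge (wedge (kahler_form a) psi) (conj_form psi))).
Proof.
move=> En; case: _ / (esym En) in a *; move=> ba [mu [fmu psiE]] [x0 psi0].
pose s := codom mu; have sz_s : size s = q by rewrite size_codom_ord.
have psis y : psi y = fdet s y by rewrite psiE wedges_fdet.
have [M EM] := basis10_coord ba fmu.
have freeM : row_free M.
  have : (fmx s x0) \in unitmx by rewrite unitmxE unitfE -/(fdet s x0) -psis.
  have -> : fmx s x0 = M *m \matrix_(j, l) a j (x0 l).
    apply/matrixP => i l; rewrite !mxE nth_codom_ord EM.
    by apply: eq_bigr => j _; rewrite mxE.
  rewrite -row_free_unit -!row_leq_rank => /leq_trans-> //.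
  exact: mxrankM_maxl.
pose b j (i : 'I_q.+1) := oapp mu (a j) (unlift ord0 i).
pose S j : 'M[C]_(1 + q) := col_mx (delta_mx 0 j) M.
have Eb j i u : b j i u = \sum_l S j i l * a l u.
  rewrite /b; case: unliftP => [i'|] ->.
    have -> : lift ord0 i' = rshift 1 i' by apply: val_inj.
    by rewrite /= EM; apply: eq_bigr => l _; rewrite col_mxEd.
  have -> : ord0 = lshift q (0 : 'I_1) by apply: val_inj.
  rewrite -[LHS](sum_1mx a j u); apply: eq_bigr => l _.
  by rewrite col_mxEu !mxE eqxx eq_sym.
have codom_b j : codom (b j) = a j :: s.
  rewrite codomS /b unlift_none /=; congr (_ :: _).
  by apply: eq_codom => i; rewrite liftK.
pose z := \sum_j \det (S j) * (\det (S j))^*%C.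
have [c c0 zE] : exists2 c : R, 0 < c & z = c%:C%C.
  apply: gt0_complex; rewrite lt_def; apply/andP; split; last first.
    by apply: sumr_ge0 => j _; apply: mul_conjC_ge0.
  have [j dj] := exists_det_col_mx_neq0 freeM.
  apply: contra dj => /eqP z0; rewrite -mul_conjC_eq0; apply/eqP.
  by apply: (psumr_eq0P _ z0) => // i _; apply: mul_conjC_ge0.
have Em : (q.+1).*2 = (1 + 1 + q + q)%N by rewrite -addnn addnS -addnA.
exists c, a, Em; split=> // x; rewrite /scale_form.
rewrite (@wedgeZ _ _ _ _ 1 1 _
  (fun y => \sum_j 'i%C * fdet ([:: a j; conjf (a j)] ++ s) y)
  _ (fdet (map conjf s))); first last.
- by move=> y; rewrite mul1r /conj_form psis conj_fdet.
- move=> y; rewrite mul1r.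
  rewrite (@eq_wedge _ _ _ _ _ (fun y => \sum_j 'i%C * fdet [:: a j; conjf (a j)] y)
    _ (fdet s)); [|exact: kahler_form_fdet|exact: psis].
  rewrite wedge_suml; apply: eq_bigr => j _; congr (_ * _).
  by rewrite -(@wedge_fdet _ _ (1 + 1) q).
rewrite wedge_suml !mul1r std_volume_fdet -zE /z mulr_suml mulr_sumr.
apply: eq_bigr => j _.
rewrite (@wedge_fdet _ _ (1 + 1 + q) q) /= ?sz_s //.
rewrite (@fdet_move _ _ _ s _ x (a j) (conjf (a j))); last first.
  by rewrite sz_s -addnA add2n !ltnS leq_addr.
rewrite sz_s !mulrA -[conjf (a j) :: _]/(map conjf (a j :: s)) -cat_cons -codom_b.
rewrite (fdet_conj_change x _ (Eb j)); last by rewrite -Em addnn.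
rewrite (mulrC _ 'i%C) -expCi_sqrS.
by rewrite fdet_cast [RHS]mulrAC [RHS]mulrC.
Qed.

Definition kahler_pairing n (a : 'I_n -> g -> C) u v :=
  \sum_j 'i%C * (a j u * conjf (a j) v - a j v * conjf (a j) u).

Lemma kahler_formE n (a : 'I_n -> g -> C) y :
  kahler_form a y = kahler_pairing a (y ord0) (y ord_max).
Proof. by rewrite kahler_form_fdet; apply: eq_bigr => j _; rewrite fdet2. Qed.

Lemma kahler_form_closed n (a : 'I_n -> g -> C) (lam : 'I_n -> C) (xi : g -> R) x :
  (forall j, lam j + (lam j)^*%C = 0) ->
  (forall j u v, a j (L u v) = lam j * ((xi u)%:C%C * a j v - (xi v)%:C%C * a j u)) ->
  ce_diff L (kahler_form a) x = 0.
Proof.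
move=> lam_im aL; rewrite (ce_diff2 _ _ (kahler_formE a)) /kahler_pairing.
rewrite -sumrN -big_split -sumrB big1 // => j _.
have aLc u v : conjf (a j) (L u v) =
    - lam j * ((xi u)%:C%C * conjf (a j) v - (xi v)%:C%C * conjf (a j) u).
  have -> : - lam j = (lam j)^*%C by apply/eqP; rewrite eq_sym -addr_eq0 addrC lam_im.
  rewrite /conjf aL conjcM; congr (_ * _).
  transitivity (((xi u)%:C%C * a j v)^*%C - ((xi v)%:C%C * a j u)^*%C).
    exact: (rmorphB (@conjc R)).
  by rewrite !conjcM !conjc_real.
by rewrite /= !aLc !aL; apply: kahler_cocycle.
Qed.

Lemma kahler_of_diagonal_basis n (a : 'I_n -> g -> C) (lam : 'I_n -> C) (xi : g -> R) :
  (1 < n)%N -> basis10 J a ->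
  (forall j, lam j + (lam j)^*%C = 0) ->
  (forall j u v, a j (L u v) = lam j * ((xi u)%:C%C * a j v - (xi v)%:C%C * a j u)) ->
  p_kahler J L n 1 (kahler_form a).
Proof.
move=> n1 ba lam_im aL; split.
- exact: n1.
- exists n, (fun=> 'i%C), (fun t _ => a t), (fun t _ => a t).
  by split=> // t _; apply: ba.1.
- exact: kahler_form_real.
- move=> psi; apply: kahler_form_transverse => //.
  by rewrite subn1 prednK // ltnW.
- by move=> x; apply: kahler_form_closed lam_im aL.
Qed.

End KahlerForm.

(** * Adapted frames of almost abelian Lie algebras *)

Lemma trace_coord (F : fieldType) (V : vectType F) m m' (b : m.-tuple V)
    (b' : m'.-tuple V) (f : 'End(V)) :
  basis_of {:V} b -> basis_of {:V} b' ->
  \sum_(i < m) coord b i (f b`_i) = \sum_(j < m') coord b' j (f b'`_j).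
Proof.
move=> bb bb'.
transitivity (\sum_(i < m) \sum_(j < m') coord b' j b`_i * coord b i (f b'`_j)).
  apply: eq_bigr => i _; rewrite {1}(coord_basis bb' (memvf b`_i)).
  by rewrite !linear_sum; apply: eq_bigr => j _; rewrite !linearZ.
rewrite exchange_big; apply: eq_bigr => j _ /=.
rewrite [in RHS](coord_basis bb (memvf (f b'`_j))) linear_sum.
by apply: eq_bigr => i _; rewrite linearZ mulrC.
Qed.

Section Frame.
Variables (R : realType) (g : vectType R) (L : lie_algebra g) (J : 'End(g)).

(** The data extracted from the algebraic hypotheses: the ideal is the kernel of
    xi and contains every frame vector but the first, and B is the matrix of
    ad X.  [frame_J] is integrability restricted to the maximal complex subspace
    of the ideal. *)
Record adapted_frame m (xi : g -> R) (X : g) (e : 'I_m -> g) (B : 'M[R]_m) : Prop :=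
  AdaptedFrame {
  frame_lin : forall r u v, xi (r *: u + v) = r * xi u + xi v;
  frame_X : xi X = 1;
  frame_JX : xi (J X) = 0;
  frame_ideal : forall v, xi (L X v) = 0;
  frame_bracket : forall u v, L u v = xi u *: L X v - xi v *: L X u;
  frame_J : forall u, xi u = 0 -> xi (J u) = 0 -> L X (J u) = J (L X u);
  frame_span : forall u, exists r : 'I_m -> R, u = \sum_j r j *: e j;
  frame_xi : forall j : 'I_m, j != 0%N :> nat -> xi (e j) = 0;
  frame_ad : forall j, L X (e j) = \sum_i B i j *: e i;
  frame_trace : \tr B = 0
}.

Lemma lie_skew u v : L u v = - L v u.
Proof.
have := lie_alternating L (u + v).
rewrite linearDr linearDl /= !linearDl /= !lie_alternating add0r addr0.
by move/eqP; rewrite addrC addr_eq0 => /eqP.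
Qed.

Lemma basis_cons_hyperplane (h : {vspace g}) v :
  (\dim h).+1 = \dim {:g} -> v \notin h -> basis_of {:g} (v :: vbasis h).
Proof.
move=> dim_h vh; rewrite basisEfree subvf -dim_h /= size_tuple leqnn andbT.
by rewrite free_cons (span_basis (vbasisP h)) vh (basis_free (vbasisP h)).
Qed.

Lemma exists_adapted_frame m : m = \dim {:g} -> unimodular L -> almost_abelian L ->
  complex_structure L J ->
  exists xi X e B, @adapted_frame m xi X e B.
Proof.
move=> Em uniL [h [dim_h idealh abelh]] [JJ intJ]; rewrite -dim_h in Em.
have [X0 X0h] : exists X0, X0 \notin h.
  pose X0 := vpick (h^C)%VS; exists X0; apply/negP => X0h.
  have : X0 \in (h :&: h^C)%VS by rewrite memv_cap X0h memv_pick.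
  rewrite capv_compl memv0 vpick0 -dimv_eq0 dimv_compl -dim_h.
  by rewrite subSnn.
pose b0 := [tuple of X0 :: vbasis h].
have bb0 : basis_of {:g} b0 by exact: basis_cons_hyperplane.
have fb0 := basis_free bb0.
pose xi : g -> R := coord b0 ord0.
have xi_lin r u v : xi (r *: u + v) = r * xi u + xi v by rewrite /xi linearP.
have xi_h u : u \in h -> xi u = 0.
  move=> uh; rewrite (coord_vbasis uh) /xi linear_sum big1 // => i _ /=.
  rewrite linearZ /= -[(vbasis h)`_i]/(b0`_(lift ord0 i)) coord_free //=.
  by rewrite mulr0.
have xi_X0 : xi X0 = 1 by rewrite /xi -[X0]/(b0`_(@ord0 (\dim h))) coord_free.
have h_xi u : xi u = 0 -> u \in h.
  move=> xiu; rewrite (coord_basis bb0 (memvf u)) big_ord_recl -/(xi u) xiu scale0r add0r.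
  apply: memv_suml => i _; rewrite memvZ //= vbasis_mem //.
  by rewrite add0n mem_nth // size_tuple.
(* The scalar that normalises xi X = 1 when X is the combination of X0 and J X0
   on which xi o J vanishes. *)
pose c := xi (J X0); pose k := (1 + c ^+ 2)^-1.
pose X := k *: (c *: J X0 + X0).
have c2 : 1 + c ^+ 2 != 0 by rewrite gt_eqF // ltr_pwDl ?sqr_ge0.
have xi0 : xi 0 = 0 by apply: xi_h; exact: mem0v.
have xiZ r u : xi (r *: u) = r * xi u by rewrite -[r *: u]addr0 xi_lin xi0 addr0.
have xi_X : xi X = 1 by rewrite xiZ xi_lin -/c xi_X0 addrC -expr2 mulVf.
have xi_JX : xi (J X) = 0.
  by rewrite linearZ linearP /= JJ xiZ xi_lin -scaleN1r xiZ -/c xi_X0 mulr1 mulrN1 addNr mulr0.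
clearbody X; have Xh : X \notin h by apply/negP => /xi_h/eqP; rewrite xi_X oner_eq0.
have dec u : u - xi u *: X \in h.
  by apply: h_xi; rewrite addrC -scaleNr xi_lin xi_X mulr1 addNr.
have LX v : L X v = L X (v - xi v *: X).
  by rewrite linearBr /= linearZr_LR /= lie_alternating scaler0 subr0.
pose b := [tuple of X :: vbasis h].
have bb : basis_of {:g} b by exact: basis_cons_hyperplane.
have xi_L v : xi (L X v) = 0 by apply: xi_h; rewrite LX idealh.
exists xi, X; case: _ / (esym Em).
exists (fun i : 'I_(\dim h).+1 => b`_i), (\matrix_(i, j) coord b i (L X b`_j)); split=> //.
- have L_dec u' v' s t : u' \in h -> v' \in h ->
      L (u' + s *: X) (v' + t *: X) = s *: L X v' - t *: L X u'.
    move=> u'h v'h; rewrite linearDl /= !linearDr /= abelh // add0r.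
    rewrite !linearZl_LR /= !linearZr_LR /= lie_alternating !scaler0 addr0.
    by rewrite lie_skew scalerN addrC.
  move=> u v; rewrite -[in LHS](subrK (xi u *: X) u) -[in LHS](subrK (xi v *: X) v).
  by rewrite L_dec // -!LX.
- move=> u xiu xiJu; have /eqP := intJ X u; rewrite /nijenhuis.
  rewrite abelh ?h_xi // [L (J X) u]abelh ?h_xi // raddf0 subr0 sub0r.
  rewrite -opprD oppr_eq0 addr_eq0 => /eqP JLJ.
  by have := congr1 J JLJ; rewrite JJ raddfN => /oppr_inj.
- move=> u; exists (fun j => coord b j u).
  exact: coord_basis bb (memvf u).
- case=> -[|j] //= lt_j _; apply: xi_h; rewrite vbasis_mem // mem_nth //.
  by rewrite size_tuple.
- move=> j; rewrite {1}(coord_basis bb (memvf (L X b`_j))).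
  by apply: eq_bigr => i _; rewrite mxE.
- have := uniL X; rewrite /lie_trace => <-.
  transitivity (\sum_(i < (\dim h).+1) coord b i (ad L X b`_i)).
    by apply: eq_bigr => i _; rewrite mxE lfunE.
  rewrite (trace_coord _ bb (vbasisP {:g})); apply: eq_bigr => i _.
  by rewrite !mxE /= passmx.vecof_delta.
Qed.

End Frame.

(** * Closed forms restrict to invariant forms *)

Section Columns.
Variables (F : comNzRingType) (T : Type).

Definition replace_point m (y : 'I_m -> T) j v : 'I_m -> T :=
  fun l => if l == j then v else y l.

Lemma fdet_col_front k s (y : 'I_k.+1 -> T) (z : 'I_k.+1 -> T) j v :
  z ord0 = v -> (forall l, z (lift ord0 l) = y (lift j l)) ->
  fdet s z = (-1) ^+ j * @fdet F T _ s (replace_point y j v).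
Proof.
move=> z0 zl; rewrite /fdet (expand_det_col _ ord0) (expand_det_col _ j) mulr_sumr.
apply: eq_bigr => i _; rewrite !mxE /replace_point eqxx z0 /cofactor addn0 exprD.
have -> : row' i (col' ord0 (fmx s z)) = row' i (col' j (fmx s (replace_point y j v))).
  by apply/matrixP => a b; rewrite !mxE zl /replace_point eq_sym (negbTE (neq_lift j b)).
rewrite [RHS]mulrCA; congr (_ * _).
by rewrite [(-1) ^+ i * (-1) ^+ j]mulrC -[in RHS]mulrA signrMK.
Qed.

Lemma sum_fdet_replace_point m s (phi : T -> T) (x : 'I_m -> T) :
  \sum_j @fdet F T _ s (replace_point x j (phi (x j)))
  = \tr ((\matrix_(i, j) nth (fun=> 0) s i (phi (x j))) *m \adj (fmx s x)).
Proof.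
rewrite -sum_det_replace_col; apply: eq_bigr => j _; congr (\det _).
by apply/matrixP => a b; rewrite !mxE /replace_point; case: eqP => // ->.
Qed.
End Columns.

Section Closed.
Variables (R : realType) (g : vectType R) (L : lie_algebra g) (J : 'End(g)).
Local Notation C := R[i].

Variables (m : nat) (xi : g -> R) (X : g) (e : 'I_m -> g) (B : 'M[R]_m).
Hypothesis frame : adapted_frame L J xi X e B.

Lemma lie_kernel0 u v : xi u = 0 -> xi v = 0 -> L u v = 0.
Proof. by move=> xu xv; rewrite (frame_bracket frame) xu xv !scale0r subrr. Qed.

Variables (N k' : nat) (c : 'I_N -> C) (A : 'I_N -> seq (g -> C)).
Local Notation k := k'.+1.
Hypothesis A_rlin : forall t, all_rlin (A t).
Let W : kform g k := fun y => \sum_t c t * fdet (A t) y.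

Lemma form_zero y l : y l = 0 -> W y = 0.
Proof.
move=> yl; rewrite /W big1 // => t _; rewrite (@fdet_col0 _ _ _ _ _ l) ?mulr0 // => i.
by rewrite yl; apply: rlin0; apply: A_rlin.
Qed.

(** Contract dw with X and evaluate on the ideal: brackets of two elements of the
    ideal vanish, and what remains is the derivative of w along ad X. *)
Lemma closed_invariant (w : kform g k) : (forall y, w y = W y) ->
  (forall x, ce_diff L w x = 0) ->
  forall y : 'I_k -> g, (forall j, xi (y j) = 0) ->
  \sum_t c t * \sum_j fdet (A t) (replace_point y j (L X (y j))) = 0.
Proof.
move=> wE dw y xiy; pose x (j : 'I_k.+1) := oapp y X (unlift ord0 j).
have x0 : x ord0 = X by rewrite /x unlift_none.
have xS j : x (lift ord0 j) = y j by rewrite /x liftK.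
have := dw x; rewrite /ce_diff big_ord_recl [X in _ + X]big1; last first.
  move=> i _; rewrite big1 // => j; case: (unliftP ord0 j) => [j'|] -> //= _.
  rewrite wE (@form_zero _ ord0) ?mulr0 //=.
  by rewrite !xS lie_kernel0.
rewrite addr0 big_mkcond big_ord_recl /= add0r.
under eq_bigr => j _.
  rewrite /= wE x0 xS mulr_sumr.
  under eq_bigr => t _.
    rewrite (@fdet_col_front _ _ _ _ y _ j (L X (y j))) //; last first.
      move=> l /=.
      have -> : [seq x m0 | m0 <- enum 'I_k.+1 & (m0 != ord0) && (m0 != lift ord0 j)]
          = [seq y (lift j l) | l <- enum 'I_k'].
        rewrite enum_ordSl /= filter_map -map_comp.
        rewrite (eq_filter (a2 := fun i => i != j)) ?enum_ord_neq -?map_comp; last first.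
          by move=> i /=; rewrite (inj_eq lift_inj).
        by apply: eq_map => l' /=; rewrite xS.
      by rewrite add0n (nth_map l) ?size_enum_ord // nth_ord_enum.
    rewrite mulrCA /bump /= add0n add1n exprS -!mulrA mulN1r signrMK.
    over.
  over.
rewrite exchange_big /=.
under eq_bigr => t _ do rewrite -mulr_sumr sumrN mulrN.
by rewrite sumrN => /eqP; rewrite oppr_eq0 => /eqP.
Qed.

End Closed.

(** * Invariance of top-degree products *)

Section WedgeValue.
Variables (R : realType) (g : vectType R) (L : lie_algebra g) (J : 'End(g)).
Local Notation C := R[i].
Variables (k' q : nat).
Local Notation k := k'.+1.
Variables (xi : g -> R) (X : g) (e : 'I_(k + q) -> g) (B : 'M[R]_(k + q)).
Hypothesis frame : adapted_frame L J xi X e B.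
Variables (N : nat) (c : 'I_N -> C) (A : 'I_N -> seq (g -> C)).
Hypothesis A_rlin : forall t, all_rlin (A t).
Hypothesis A_size : forall t, size (A t) = k.

(** The value on the frame of the form with coefficients c and rows A, wedged
    with the functionals F. *)
Definition wedge_value (F : seq (g -> C)) := \sum_t c t * fdet (A t ++ F) e.

Definition along_ad (s : seq (g -> C)) i : g -> C := fun u => nth (fun=> 0) s i (L X u).

(** The derivation induced by ad X acts on top-degree forms by the trace of
    ad X, which is zero. *)
Lemma fdet_along_ad s : size s = (k + q)%N -> all_rlin s ->
  \sum_(i < k + q) fdet (set_nth (fun=> 0) s i (along_ad s i)) e = 0.
Proof.
move=> sz_s ls; rewrite (fdet_set_nth (along_ad s)) //.
have -> : \matrix_(i, j) along_ad s i (e j)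
    = fmx s e *m map_mx (@real_complex R) B :> 'M_(k + q).
  apply/matrixP => i j; rewrite !mxE /along_ad (frame_ad frame) rlin_sum; last exact: ls.
  by apply: eq_bigr => l _; rewrite !mxE mulrC; apply: rlinZ; apply: ls.
rewrite -mulmxA mxtrace_mulC -mulmxA mul_adj_mx mul_mx_scalar mxtraceZ.
by rewrite trace_map_mx (frame_trace frame) rmorph0 mulr0.
Qed.

Hypothesis A_closed : forall y : 'I_k -> g, (forall j, xi (y j) = 0) ->
  \sum_t c t * \sum_j fdet (A t) (replace_point y j (L X (y j))) = 0.

(** Expand along the rows of the closed form.  If the frame vector outside the
    ideal falls in the block of the other functionals, the first factor is the
    derivative of the closed form on vectors of the ideal, which is zero;
    otherwise the row of xi in the second factor is zero. *)
Lemma closed_rows_vanish F (i0 : 'I_q) : size F = q ->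
  (forall u, nth (fun=> 0) F i0 u = (xi u)%:C%C) ->
  \sum_t c t * \sum_(i < k) fdet (set_nth (fun=> 0) (A t) i (along_ad (A t) i) ++ F) e = 0.
Proof.
move=> sz_F Fi0; have kq0 : ((k`! * q`!)%:R : C) != 0.
  by rewrite pnatr_eq0 -lt0n muln_gt0 !fact_gt0.
apply: (mulfI kq0); rewrite mulr0 mulr_sumr.
under eq_bigr => t _.
  rewrite mulrCA mulr_sumr.
  under eq_bigr => i _.
    rewrite -fdet_cat ?size_set_nth ?A_size; last by apply/maxn_idPr.
    over.
  rewrite exchange_big mulr_sumr; over.
rewrite exchange_big big1 // => r _ /=.
set y := fun i : 'I_k => e (r (lshift q i)).
case: (altP (@forallP _ (fun j : 'I_q => r (rshift k j) != 0%N :> nat))) => [no0|].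
  rewrite big1 // => t _; rewrite big1 ?mulr0 // => i _.
  rewrite [X in _ * X](@fdet_row0 _ _ _ _ _ i0) ?mulr0 // => j.
  by rewrite Fi0 (frame_xi frame) ?rmorph0.
case/forallPn => j0; rewrite negbK => /eqP rj0.
have xiy i : xi (y i) = 0.
  apply: (frame_xi frame); rewrite -rj0; apply/eqP => /val_inj/perm_inj E.
  have := congr1 (@nat_of_ord _) E => /= Ei.
  by have := ltn_ord i; rewrite Ei ltnNge leq_addr.
have := A_closed xiy => top0.
transitivity (((-1) ^+ r * fdet F (fun i : 'I_q => e (r (rshift k i)))) *
   \sum_t c t * \sum_j fdet (A t) (replace_point y j (L X (y j)))); last by rewrite top0 mulr0.
rewrite mulr_sumr; apply: eq_bigr => t _; rewrite [RHS]mulrCA; congr (_ * _).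
rewrite (sum_fdet_replace_point (A t) (L X) y) -(fdet_set_nth (along_ad (A t))) // mulr_sumr.
by apply: eq_bigr => i _; rewrite mulrAC.
Qed.

Lemma wedge_value_invariant F (i0 : 'I_q) : size F = q -> all_rlin F ->
  (forall u, nth (fun=> 0) F i0 u = (xi u)%:C%C) ->
  \sum_(i < q) wedge_value (set_nth (fun=> 0) F i (along_ad F i)) = 0.
Proof.
move=> sz_F lF Fi0; have top0 := closed_rows_vanish sz_F Fi0.
rewrite -[LHS]add0r -[X in X + _]top0 /wedge_value exchange_big -big_split big1 //= => t _.
rewrite -mulr_sumr -mulrDr [X in _ * X](_ : _ = 0) ?mulr0 //.
have lAF : all_rlin (A t ++ F).
  by move=> i; rewrite nth_cat; case: ifP => _; [apply: A_rlin | apply: lF].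
rewrite -[RHS](@fdet_along_ad (A t ++ F)) ?size_cat ?A_size ?sz_F // big_split_ord /=.
congr (_ + _); apply: eq_bigr => i _; congr (fdet _ e).
  rewrite set_nth_catl ?A_size //; congr (set_nth _ _ _ _ ++ _).
  by rewrite /along_ad nth_cat A_size ltn_ord.
rewrite -(A_size t) set_nth_catr; congr (_ ++ set_nth _ _ _ _).
by rewrite /along_ad nth_cat ltnNge leq_addr /= addKn.
Qed.

End WedgeValue.

(** * Dependent rows and products of four functionals *)

Section Span.
Variables (F : fieldType) (T : Type).
Implicit Types (f : T -> F) (s t : seq (T -> F)).

(** Coefficients are indexed by natural numbers so that they can be reused when
    the list t is extended. *)
Definition inspan t f := exists r : nat -> F,
  forall u, f u = \sum_(j < size t) r j * nth (fun=> 0) t j u.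

Lemma inspan_lin t f1 f2 f a b : inspan t f1 -> inspan t f2 ->
  (forall u, f u = a * f1 u + b * f2 u) -> inspan t f.
Proof.
move=> [r1 E1] [r2 E2] E; exists (fun j => a * r1 j + b * r2 j) => u.
rewrite E E1 E2 !mulr_sumr -big_split; apply: eq_bigr => j _ /=.
by rewrite mulrDl !mulrA.
Qed.

Lemma inspan_catl t t' f : inspan t f -> inspan (t ++ t') f.
Proof.
case=> r E; exists (fun j => if (j < size t)%N then r j else 0) => u.
rewrite size_cat big_split_ord /= [X in _ + X]big1 ?addr0 => [|j _].
  by rewrite E; apply: eq_bigr => j _; rewrite nth_cat ltn_ord.
by rewrite ltnNge leq_addr mul0r.
Qed.

Lemma inspan_catr t t' f : inspan t f -> inspan (t' ++ t) f.
Proof.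
case=> r E; exists (fun j => if (j < size t')%N then 0 else r (j - size t')%N) => u.
rewrite size_cat big_split_ord /= big1 ?add0r => [|j _]; last by rewrite ltn_ord mul0r.
by rewrite E; apply: eq_bigr => j _; rewrite nth_cat ltnNge leq_addr /= addKn.
Qed.

Lemma inspan_nth t i : inspan t (nth (fun=> 0) t i).
Proof.
exists (fun j => (j == i)%:R) => u; case: (ltnP i (size t)) => lt_i.
  rewrite (bigD1 (Ordinal lt_i)) //= eqxx mul1r big1 ?addr0 // => j.
  by rewrite -val_eqE /= => /negbTE ->; rewrite mul0r.
rewrite nth_default // big1 // => j _.
by rewrite ltn_eqF ?mul0r // (leq_trans (ltn_ord j)).
Qed.

Definition all_inspan t s := forall i, inspan t (nth (fun=> 0) s i).

Lemma all_inspan_cons t f s : inspan t f -> all_inspan t s -> all_inspan t (f :: s).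
Proof. by move=> tf ts [|i]; [exact: tf | exact: ts]. Qed.

Lemma all_inspan_nil t : all_inspan t [::].
Proof.
by move=> i; exists (fun=> 0) => u; rewrite nth_nil big1 // => j _; rewrite mul0r.
Qed.

Lemma all_inspan_cat t s s' : all_inspan t s -> all_inspan t s' -> all_inspan t (s ++ s').
Proof. by move=> ts ts' i; rewrite nth_cat; case: ifP. Qed.

Lemma fdet_inspan m t s (x : 'I_m -> T) : (size t < m)%N -> all_inspan t s ->
  fdet s x = 0.
Proof.
move=> lt_tm ts; have [r Er] := fin_all_exists (fun i : 'I_m => ts i).
apply: (@fdet_small_span _ _ _ _ s t (\matrix_(i < m, j < size t) r i j)) => // i u.
by rewrite Er; apply: eq_bigr => j _; rewrite mxE.
Qed.

End Span.

Section Trilinear.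
Variables (F : comNzRingType) (T : Type) (k : nat).
Variables (e : 'I_(k + 4) -> T) (s : seq (T -> F)).
Hypothesis sz_s : size s = k.
Local Notation D f1 f2 f3 f4 := (fdet (s ++ [:: f1; f2; f3; f4]) e).
Implicit Types (f h : T -> F).

Lemma fdet4_lin1 a b f f' h f2 f3 f4 : (forall u, h u = a * f u + b * f' u) ->
  D h f2 f3 f4 = a * D f f2 f3 f4 + b * D f' f2 f3 f4.
Proof. by move=> E; apply: fdet_lin E; rewrite sz_s -[X in (X < _)%N]addn0 ltn_add2l. Qed.

Lemma fdet4_lin2 a b f f' h f1 f3 f4 : (forall u, h u = a * f u + b * f' u) ->
  D f1 h f3 f4 = a * D f1 f f3 f4 + b * D f1 f' f3 f4.
Proof.
move=> E; rewrite -!(cat_rcons f1); apply: fdet_lin E.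
by rewrite size_rcons sz_s -[X in (X < _)%N]addn1 ltn_add2l.
Qed.

Lemma fdet4_lin3 a b f f' h f1 f2 f4 : (forall u, h u = a * f u + b * f' u) ->
  D f1 f2 h f4 = a * D f1 f2 f f4 + b * D f1 f2 f' f4.
Proof.
move=> E; rewrite -!(cat_rcons f1) -!(cat_rcons f2); apply: fdet_lin E.
by rewrite !size_rcons sz_s -[X in (X < _)%N]addn2 ltn_add2l.
Qed.

Lemma fdet4_swap12 f1 f2 f3 f4 : D f1 f2 f3 f4 = - D f2 f1 f3 f4.
Proof. by apply: fdet_swap; rewrite sz_s -[X in (X < _)%N]addn1 ltn_add2l. Qed.

Lemma fdet4_swap23 f1 f2 f3 f4 : D f1 f2 f3 f4 = - D f1 f3 f2 f4.
Proof.
rewrite -!(cat_rcons f1); apply: fdet_swap.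
by rewrite size_rcons sz_s -[X in (X < _)%N]addn2 ltn_add2l.
Qed.

Lemma fdet4_swap34 f1 f2 f3 f4 : D f1 f2 f3 f4 = - D f1 f2 f4 f3.
Proof.
rewrite -!(cat_rcons f1) -!(cat_rcons f2); apply: fdet_swap.
by rewrite !size_rcons sz_s -[X in (X < _)%N]addn3 ltn_add2l.
Qed.

Lemma fdet4_alt12 f f3 f4 : D f f f3 f4 = 0.
Proof.
by apply: (@fdet_alt _ _ _ _ [::]); rewrite sz_s addn1 -[X in (X < _)%N]addn1 ltn_add2l.
Qed.

Lemma fdet4_alt13 f f2 f4 : D f f2 f f4 = 0.
Proof. by rewrite fdet4_swap23 fdet4_alt12 oppr0. Qed.

(** With h = alpha and h' = conj alpha this turns the product
    alpha /\ f2 /\ conj alpha /\ f4 into a multiple of f2 /\ f4 /\ eta /\ xi. *)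
Lemma fdet4_split (i : F) f1 f2 f3 f4 h h' :
  (forall u, h u = 1 * f1 u + i * f3 u) -> (forall u, h' u = 1 * f1 u + - i * f3 u) ->
  D h f2 h' f4 = - (i *+ 2) * D f2 f4 f3 f1.
Proof.
move=> Eh Eh'; rewrite (fdet4_lin3 _ _ _ Eh') !(fdet4_lin1 _ _ _ Eh) !fdet4_alt13.
have -> : D f3 f2 f1 f4 = - D f2 f4 f3 f1.
  by rewrite fdet4_swap12 fdet4_swap34 opprK fdet4_swap23.
have -> : D f1 f2 f3 f4 = D f2 f4 f3 f1.
  by rewrite fdet4_swap12 fdet4_swap23 opprK fdet4_swap34 fdet4_swap23 opprK.
by rewrite mulr0 add0r mulr0 addr0 !mul1r mulrN mulNr -opprD -mulrDl -mulr2n mulNr.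
Qed.

End Trilinear.

(** * The forms xi, eta and alpha of a frame *)

Lemma lift0_rshift q (i : 'I_q) : lift ord0 i = rshift 1 i.
Proof. exact: val_inj. Qed.

Lemma ord0_lshift q : ord0 = lshift q (0 : 'I_1).
Proof. exact: val_inj. Qed.

Section FrameForms.
Variables (R : realType) (g : vectType R) (L : lie_algebra g) (J : 'End(g)).
Local Notation C := R[i].
Variables (m : nat) (xi : g -> R) (X : g) (e : 'I_m -> g) (B : 'M[R]_m).
Hypothesis frame : adapted_frame L J xi X e B.
Hypothesis JJ : forall x, J (J x) = - x.

Definition eta u := - xi (J u).
Definition xiC u : C := (xi u)%:C%C.
Definition etaC u : C := (eta u)%:C%C.
(** The factor 1 gives alpha and its conjugate the same shape, a linear
    combination of two functionals, on which [fdet4_split] operates. *)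
Definition alpha u : C := 1 * xiC u + 'i%C * etaC u.

Lemma xiD u v : xi (u + v) = xi u + xi v.
Proof. by rewrite -[u]scale1r (frame_lin frame) mul1r scale1r. Qed.

Lemma xi0 : xi 0 = 0.
Proof. by have /eqP := xiD 0 0; rewrite addr0 -subr_eq0 opprD addNKr oppr_eq0 => /eqP. Qed.

Lemma xiZ r u : xi (r *: u) = r * xi u.
Proof. by rewrite -[r *: u]addr0 (frame_lin frame) xi0 addr0. Qed.

Lemma xiN u : xi (- u) = - xi u.
Proof. by rewrite -scaleN1r xiZ mulN1r. Qed.

Lemma rlin_xiC : rlin xiC.
Proof. by move=> r u v; rewrite /xiC (frame_lin frame) rmorphD rmorphM. Qed.

Lemma eta_lin r u v : eta (r *: u + v) = r * eta u + eta v.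
Proof. by rewrite /eta linearP (frame_lin frame) opprD mulrN. Qed.

Lemma rlin_etaC : rlin etaC.
Proof. by move=> r u v; rewrite /etaC eta_lin rmorphD rmorphM. Qed.

Lemma eta_J u : eta (J u) = xi u.
Proof. by rewrite /eta JJ xiN opprK. Qed.

Lemma xi_J u : xi (J u) = - eta u. Proof. by rewrite opprK. Qed.

Lemma form10_alpha : form10 J alpha.
Proof.
split=> [r u v|u].
  by rewrite /alpha rlin_xiC rlin_etaC !mul1r mulrDr mulrDr mulrCA addrACA.
rewrite /alpha /xiC /etaC eta_J xi_J !mul1r mulrDr mulrA -expr2 sqr_iC mulN1r.
by rewrite rmorphN addrC.
Qed.

Lemma conjf_alpha u : conjf alpha u = 1 * xiC u + - 'i%C * etaC u.
Proof.
rewrite /conjf /alpha !mul1r -conjci; transitivity ((xiC u)^*%C + ('i%C * etaC u)^*%C).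
  exact: (rmorphD (@conjc R)).
by rewrite conjcM /xiC /etaC !conjc_real.
Qed.

Lemma alpha_X : alpha X = 1.
Proof.
rewrite /alpha /xiC /etaC /eta (frame_JX frame) (frame_X frame) oppr0.
by rewrite rmorph0 mulr0 addr0 mulr1.
Qed.

(** This is ad X composed with the projection of g onto the maximal complex
    subspace of the ideal, along X and J X; unlike ad X it commutes with J. *)
Definition reduced_ad y := L X y - eta y *: L X (J X).

Definition ad_weight : R := eta (L X (J X)).

Lemma reduced_adE y : exists u, [/\ reduced_ad y = L X u,
  reduced_ad (J y) = L X (J u), xi u = 0 & xi (J u) = 0].
Proof.
pose u := y - xi y *: X - eta y *: J X.
have Ju : J u = J y - xi y *: J X + eta y *: X.
  by rewrite /u !raddfB /= !linearZ_LR /= JJ scalerN opprK.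
exists u; rewrite Ju /u; split.
- by rewrite !linearBr /= !linearZr_LR /= lie_alternating scaler0 subr0.
- rewrite /reduced_ad eta_J.
  by rewrite linearDr linearBr /= !linearZr_LR /= lie_alternating scaler0 addr0.
- by rewrite !xiD !xiN !xiZ (frame_X frame) (frame_JX frame) mulr1 mulr0 subrr subr0.
- rewrite !xiD xiN !xiZ.
  by rewrite (frame_X frame) (frame_JX frame) mulr0 mulr1 subr0 /eta subrr.
Qed.

Lemma reduced_adJ y : reduced_ad (J y) = J (reduced_ad y).
Proof.
by have [u [-> -> xu xJu]] := reduced_adE y; rewrite (frame_J frame).
Qed.

Lemma eta_ad y : eta (L X y) = eta y * ad_weight.
Proof.
have -> : L X y = eta y *: L X (J X) + reduced_ad y by rewrite addrC subrK.
rewrite eta_lin [X in _ + X](_ : _ = 0) ?addr0 // /eta -reduced_adJ.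
have [u [_ -> _ _]] := reduced_adE y.
by rewrite (frame_ideal frame) oppr0.
Qed.

Lemma form10_ad f y : form10 J f ->
  f (L X y) = f (reduced_ad y) + f (L X (J X)) * etaC y.
Proof.
case=> lf _; have -> : L X y = eta y *: L X (J X) + reduced_ad y by rewrite addrC subrK.
by rewrite lf addrC [_ * etaC y]mulrC.
Qed.

Lemma form10_reduced f : form10 J f -> form10 J (fun y => f (reduced_ad y)).
Proof.
case=> lf Jf; split=> [r u v|u]; last by rewrite reduced_adJ Jf.
rewrite -lf; congr f; rewrite /reduced_ad eta_lin linearPr /= scalerDl scalerBr scalerA.
by rewrite opprD addrACA.
Qed.

Lemma reduced_ad_X : reduced_ad X = 0.
Proof. by rewrite /reduced_ad lie_alternating /eta (frame_JX frame) oppr0 scale0r subr0. Qed.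

Lemma alpha_ad y : alpha (L X y) = 'i%C * (ad_weight%:C%C * etaC y).
Proof.
rewrite /alpha /xiC (frame_ideal frame) mul1r rmorph0 add0r /etaC eta_ad.
by rewrite rmorphM [X in _ * X]mulrC.
Qed.

(** A family of (1,0)-forms with f in front; with f = alpha and the others
    vanishing at X it is a basis adapted to the frame. *)
Definition acons q (f : g -> C) (c : 'I_q -> g -> C) : 'I_q.+1 -> g -> C :=
  fun i => oapp c f (unlift ord0 i).

Lemma acons0 q f (c : 'I_q -> g -> C) : acons f c ord0 = f.
Proof. by rewrite /acons unlift_none. Qed.

Lemma aconsS q f (c : 'I_q -> g -> C) i : acons f c (lift ord0 i) = c i.
Proof. by rewrite /acons liftK. Qed.

Lemma codom_acons q f (c : 'I_q -> g -> C) : codom (acons f c) = f :: codom c.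
Proof. by rewrite codomS acons0; congr (_ :: _); apply: eq_codom => i; rewrite aconsS. Qed.

(** Covers both the change of eigenbasis (z = 0) and the final correction of the
    eigenforms by multiples of alpha (S = 1). *)
Lemma acons_change q (f : g -> C) (c c' : 'I_q -> g -> C) (S : 'M[C]_q) (z : 'I_q -> C) :
  S \in unitmx -> basis10 J (acons f c) ->
  (forall i u, c' i u = \sum_j S i j * c j u + z i * f u) ->
  basis10 J (acons f c').
Proof.
move=> uS bc Ec; pose S1 : 'M[C]_(1 + q) := block_mx 1%:M 0 (\col_i z i) S.
apply: (@basis10_change _ _ _ _ _ _ S1) bc _.
  by rewrite unitmxE det_lblock det1 mul1r -unitmxE.
move=> i u; rewrite big_ord_recl acons0.
under eq_bigr => j _ do rewrite aconsS lift0_rshift.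
case: (unliftP ord0 i) => [i'|] ->.
  rewrite aconsS Ec addrC lift0_rshift (ord0_lshift q).
  rewrite block_mxEdl mxE; congr (_ + _); apply: eq_bigr => j _.
  by rewrite block_mxEdr.
rewrite acons0 (ord0_lshift q) block_mxEul mxE mul1r big1 ?addr0 // => j _.
by rewrite block_mxEur mxE mul0r.
Qed.

Lemma exists_hyperplane_basis q (c : 'cV[C]_q.+1) : c != 0 ->
  exists2 G : 'M[C]_(q, q.+1), row_free G & G *m c = 0.
Proof.
move=> c0; have rk : \rank (kermx c) = q.
  have : \rank c = 1%N.
    by apply/eqP; rewrite -mxrank_tr rank_rV -(inj_eq trmx_inj) trmxK trmx0 c0.
  by rewrite mxrank_ker => ->; rewrite subn1.
have : row_base (kermx c) *m c = 0 by apply/sub_kermxP; rewrite eq_row_base.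
move: (row_base_free (kermx c)); move: (row_base (kermx c)); rewrite rk => G.
by exists G.
Qed.

Lemma exists_acons_basis q (a : 'I_q.+1 -> g -> C) (f : g -> C) :
  basis10 J a -> form10 J f -> f X = 1 ->
  exists2 c : 'I_q -> g -> C, basis10 J (acons f c) & forall i, c i X = 0.
Proof.
move=> ba ff fX; have [l El] := basis10_coord ba (fun _ : 'I_1 => ff).
pose c : 'cV[C]_q.+1 := \col_j a j X.
have lc : l *m c = 1%:M.
  apply/matrixP => i j; rewrite !ord1 !mxE eqxx -fX (El 0).
  by apply: eq_bigr => j' _; rewrite mxE.
have c0 : c != 0.
  apply/eqP => c0; move: lc; rewrite c0 mulmx0 => /matrixP/(_ 0 0).
  by rewrite !mxE => /eqP; rewrite eq_sym oner_eq0.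
have [G freeG Gc] := exists_hyperplane_basis c0.
exists (fun i u => \sum_j G i j * a j u); last first.
  move=> i; have /matrixP/(_ i 0) := Gc; rewrite !mxE => Gci.
  by rewrite -[RHS]Gci; apply: eq_bigr => j _; rewrite mxE.
pose S : 'M[C]_(1 + q) := col_mx l G.
apply: (@basis10_change _ _ _ _ _ _ S) ba _.
  rewrite unitmxE unitfE; apply/det0P => -[v v0]; rewrite -[v]hsubmxK mul_row_col => vS.
  have v1 : lsubmx v = 0.
    have := congr1 (mulmx^~ c) vS; rewrite mul0mx mulmxDl -!mulmxA Gc lc.
    by rewrite mulmx0 addr0 mulmx1.
  move: vS; rewrite v1 mul0mx add0r => vG.
  case/negP: v0; rewrite -[v]hsubmxK v1.
  have -> : rsubmx v = 0 by apply: (row_free_inj freeG); rewrite vG mul0mx.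
  by rewrite row_mx0.
move=> i u; case: (unliftP ord0 i) => [i'|] ->.
  rewrite aconsS lift0_rshift.
  by apply: eq_bigr => j _; rewrite col_mxEd.
rewrite acons0 (El 0) (ord0_lshift q).
by apply: eq_bigr => j _; rewrite col_mxEu.
Qed.

End FrameForms.

(** * Transversality against a product of two (1,0)-forms *)

Section Transverse.
Variables (R : realType) (g : vectType R).
Local Notation C := R[i].
Variables (k N : nat) (c : 'I_N -> C) (A : 'I_N -> seq (g -> C)).
Hypothesis A_size : forall t, size (A t) = k.

Lemma wedge_pair_fdet (psi : kform g 2) f h (w : kform g k) x :
  (forall y, w y = \sum_t c t * fdet (A t) y) ->
  (forall y, psi y = fdet [:: f; h] y) ->
  wedge (wedge w psi) (conj_form psi) x =
  \sum_t c t * fdet (A t ++ [:: f; h; conjf f; conjf h]) x.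
Proof.
move=> wE psiE.
rewrite (@eq_wedge _ _ _ _ _ (fun y => \sum_t c t * fdet (A t ++ [:: f; h]) y) _
   (fdet [:: conjf f; conjf h])).
- rewrite wedge_suml; apply: eq_bigr => t _; rewrite wedge_fdet ?size_cat ?A_size //.
  by rewrite -catA.
- move=> y; rewrite (@eq_wedge _ _ _ _ _ (fun y => \sum_t c t * fdet (A t) y) _
     (fdet [:: f; h])) //.
  by rewrite wedge_suml; apply: eq_bigr => t _; rewrite wedge_fdet.
- by move=> y; rewrite /conj_form psiE conj_fdet.
Qed.

End Transverse.

Section TransversePair.
Variables (R : realType) (g : vectType R) (J : 'End(g)).
Local Notation C := R[i].
Variables (n p N : nat) (c : 'I_N -> C) (A : 'I_N -> seq (g -> C)).
Hypothesis A_size : forall t, size (A t) = (p + p)%N.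

Lemma transverse_pair (w : kform g (p + p)) f h x0 : (n - p = 2)%N ->
  (forall y, w y = \sum_t c t * fdet (A t) y) -> transverse J n w ->
  form10 J f -> form10 J h -> fdet [:: f; h] (x0 : 'I_2 -> g) != 0 ->
  exists2 r : R, 0 < r & exists2 a : 'I_n -> g -> C, basis10 J a &
    forall m (x : 'I_m -> g), m = (p + p + 4)%N ->
    \sum_t c t * fdet (A t ++ [:: f; h; conjf f; conjf h]) x
    = r%:C%C * ('i%C ^+ (n ^ 2) * fdet (codom a ++ map conjf (codom a)) x).
Proof.
rewrite /transverse; move: (n - p)%N => q -> wE tr ff fh fh0.
have psiE (y : 'I_2 -> g) : wedges (pair_fun f h) y = fdet [:: f; h] y.
  by rewrite wedges_fdet codom_pair_fun.
have [||r [a [En [r0 ba E]]]] := tr (wedges (pair_fun f h)).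
- by exists (pair_fun f h); split=> // j; rewrite /pair_fun; case: ifP.
- by exists x0; rewrite psiE.
exists r => //; exists a => // m x Em.
have Em' : (p + p + 2 + 2)%N = m by rewrite Em -addnA.
have := E (fun i => x (cast_ord Em' i)); rewrite /scale_form (wedge_pair_fdet A_size _ wE psiE).
rewrite std_volume_fdet (_ : 'i%C ^+ (2 ^ 2) = 1); last first.
  by rewrite (exprM _ 2 2) sqr_iC sqrrN expr1n.
rewrite mul1r => E'.
rewrite (fdet_cast En (codom a ++ _) (fun i => x (cast_ord Em' i))) fdet_cast in E'.
rewrite -E'; apply: eq_bigr => t _; by rewrite fdet_cast.
Qed.

End TransversePair.

Section ExistsForm.
Variables (R : realType) (g : vectType R).

(** Applied to xi and eta, it provides a nonzero vector on which alpha
    vanishes. *)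
Lemma exists_kernel2 (f1 f2 : g -> R) :
  (forall r u v, f1 (r *: u + v) = r * f1 u + f1 v) ->
  (forall r u v, f2 (r *: u + v) = r * f2 u + f2 v) ->
  (2 < \dim {:g})%N -> exists u, [/\ u != 0, f1 u = 0 & f2 u = 0].
Proof.
have fsum (f : g -> R) : (forall r u v, f (r *: u + v) = r * f u + f v) ->
    forall d (v : 'rV[R]_d) (b : 'I_d -> g), f (\sum_j v 0 j *: b j) = \sum_j v 0 j * f (b j).
  move=> lf d v b; have f0 : f 0 = 0.
    have /eqP := lf 1 0 0; rewrite scale1r addr0 mul1r -subr_eq0 opprD addNKr oppr_eq0.
    by move/eqP.
  elim/big_rec2: _ => [|j y1 y2 _ <-]; first exact: f0.
  exact: lf.
move=> l1 l2; set d := \dim _ => d2; pose b := vbasis {:g}.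
pose M : 'M[R]_(d, 2) := \matrix_(i, j) (if j == ord0 then f1 b`_i else f2 b`_i).
have : kermx M != 0.
  by rewrite -mxrank_eq0 mxrank_ker subn_eq0 -ltnNge (leq_ltn_trans (rank_leq_col M)).
case/rowV0Pn => v /sub_kermxP vM v0.
exists (\sum_j v 0 j *: b`_j); split.
- apply: contraNneq v0 => u0; apply/eqP/rowP => i; rewrite mxE.
  have fb : free b by exact: basis_free (vbasisP {:g}).
  by rewrite -(coord_sum_free (fun j => v 0 j) i fb) u0 linear0.
- rewrite (fsum f1 l1 d v (fun j : 'I_d => b`_j)); have /rowP/(_ ord0) := vM.
  by rewrite !mxE => M0; rewrite -[RHS]M0; apply: eq_bigr => j _; rewrite mxE.
- rewrite (fsum f2 l2 d v (fun j : 'I_d => b`_j)); have /rowP/(_ ord_max) := vM.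
  by rewrite !mxE => M0; rewrite -[RHS]M0; apply: eq_bigr => j _; rewrite mxE.
Qed.

Lemma exists_form10_neq0 (J : 'End(g)) (u : g) : (forall x, J (J x) = - x) ->
  u != 0 -> exists2 f, form10 J f & f u != 0.
Proof.
move=> JJ u0.
have [i ri] : exists i, coord (vbasis {:g}) i u != 0.
  apply/existsP; apply: contraNT u0; rewrite negb_exists => /forallP c0.
  rewrite (coord_vbasis (memvf u)) big1 // => i _.
  by move: (c0 i); rewrite negbK => /eqP ->; rewrite scale0r.
pose r := coord (vbasis {:g}) i.
have r_lin a v w : r (a *: v + w) = a * r v + r w by rewrite /r linearP.
have rN v : r (- v) = - r v by rewrite /r linearN.
exists (fun v => (r v)%:C%C - 'i%C * (r (J v))%:C%C).
  split=> [a v w|v].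
    rewrite linearP !r_lin !rmorphD !rmorphM mulrDr opprD mulrBr.
    by rewrite ['i%C * (_ * _)]mulrCA addrACA.
  rewrite JJ rN rmorphN mulrN opprK mulrBr mulrA -expr2 sqr_iC mulN1r opprK.
  by rewrite addrC.
apply: contraNneq ri => /(congr1 (@complex.Re R)).
by rewrite /= !(mul0r, mulr0, subr0, addr0, oppr0, mul1r) -/r => ru0; apply/eqP; exact: ru0.
Qed.

End ExistsForm.

Lemma sum_ord4 (V : zmodType) (G : nat -> V) :
  \sum_(i < 4) G i = G 0%N + G 1%N + G 2%N + G 3%N.
Proof. by rewrite !big_ord_recl big_ord0 addr0 !addrA. Qed.

Lemma sesq_entry (F : fieldType) (x y t kappa : F) : kappa != 0 ->
  x * y * t = kappa * (x * (t / kappa) * y).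
Proof.
move=> k0; rewrite [x * _ * y]mulrAC [kappa * _]mulrC -!mulrA mulVf // mulr1.
by rewrite !mulrA.
Qed.

Lemma skew_combine (F : comNzRingType) (x y z t w w' k : F) :
  1 * x + w * 0 + (1 * y + w' * 0) + (k * z + 0 * t) = 0 -> x + y = - k * z.
Proof.
rewrite !mulr0 !mul1r mul0r !addr0 => /eqP.
by rewrite addr_eq0 mulNr => /eqP.
Qed.

Lemma kernel_combine (F : fieldType) (y w w' l l' t t0 kappa : F) :
  kappa != 0 -> l + l' = 0 ->
  0 * t0 + w * kappa + (l * t + w' * 0) + (l' * t + y * 0) = 0 -> w = 0.
Proof.
move=> k0 ll'; rewrite !mulr0 !addr0 mul0r add0r -addrA -mulrDl ll' mul0r addr0.
by move/eqP; rewrite mulf_eq0 (negbTE k0) orbF => /eqP.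
Qed.

Lemma lin_combine (F : comNzRingType) (r z x1 x2 y1 y2 : F) :
  r * x1 + x2 + z * (r * y1 + y2) = r * (x1 + z * y1) + (x2 + z * y2).
Proof. by ring. Qed.

Lemma shear_combine (F : comNzRingType) (xu xv gu gv eu ev i l z : F) :
  xu * (l * gv + i * l * z * ev + z * (i * (0 * ev)))
  - xv * (l * gu + i * l * z * eu + z * (i * (0 * eu)))
  = l * (xu * (gv + z * (1 * xv + i * ev)) - xv * (gu + z * (1 * xu + i * eu))).
Proof. by ring. Qed.

Lemma half_diff (F : fieldType) (x y i : F) : (2%:R * i) != 0 ->
  y = (2%:R * i)^-1 * (1 * x + i * y) + - (2%:R * i)^-1 * (1 * x + - i * y).
Proof.
move=> i0; rewrite mulNr -mulrBr opprD mulNr opprK addrACA subrr add0r.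
by rewrite -mulr2n -[(i * y) *+ 2]mulr_natl mulrA mulKf.
Qed.

Lemma half_sum (F : fieldType) (x y i : F) : 2%:R != 0 :> F ->
  x = 2%:R^-1 * (1 * x + i * y) + 2%:R^-1 * (1 * x + - i * y).
Proof.
move=> n2; rewrite -mulrDr addrACA mulNr subrr addr0 !mul1r.
by rewrite -mulr2n -[x *+ 2]mulr_natl mulKf.
Qed.

(** * The invariant Hermitian pairing *)

Section HermitianPairing.
Local Open Scope sesquilinear_scope.
Variables (R : realType) (g : vectType R) (L : lie_algebra g) (J : 'End(g)).
Local Notation C := R[i].
Variable k0 : nat.
Local Notation n := k0.+3.
Local Notation q := k0.+2.
Local Notation k := (k0 + k0.+1).+1.
Hypothesis JJ : forall x, J (J x) = - x.
Variables (xi : g -> R) (X : g) (e : 'I_(k + 4) -> g) (B : 'M[R]_(k + 4)).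
Hypothesis frame : adapted_frame L J xi X e B.
Variables (N : nat) (c : 'I_N -> C).
Variables (a b : 'I_N -> 'I_k0.+1 -> g -> C).
Hypothesis a10 : forall t i, form10 J (a t i).
Hypothesis b10 : forall t i, form10 J (b t i).
Local Notation A := (pq_rows a b).
(* The two properties of the given form, with rows A and coefficients c:
   invariance of its restriction to the ideal, and transversality against
   f /\ h. *)
Hypothesis A_closed : forall y : 'I_k -> g, (forall j, xi (y j) = 0) ->
  \sum_t c t * \sum_j fdet (A t) (replace_point y j (L X (y j))) = 0.
Hypothesis A_pos : forall f h (x0 : 'I_2 -> g), form10 J f -> form10 J h ->
  fdet [:: f; h] x0 != 0 ->
  exists2 r : R, 0 < r & exists2 a : 'I_n -> g -> C, basis10 J a &
    \sum_t c t * fdet (A t ++ [:: f; h; conjf f; conjf h]) e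
    = r%:C%C * ('i%C ^+ (n ^ 2) * fdet (codom a ++ map conjf (codom a)) e).

Local Notation eta := (eta J xi).
Local Notation xiC := (xiC xi).
Local Notation etaC := (etaC J xi).
Local Notation alpha := (alpha J xi).

(** The value of Omega /\ f1 /\ f2 /\ f3 /\ xi on the frame.  The factor xi
    restricts everything to the ideal. *)
Definition top_pairing f1 f2 f3 := wedge_value e c A [:: f1; f2; f3; xiC].

(** Linearity in a functional, stated pointwise so that h ranges over all
    functions with the given values. *)
Definition flinear (phi : (g -> C) -> C) := forall s t f f' h,
  (forall u, h u = s * f u + t * f' u) -> phi h = s * phi f + t * phi f'.

Lemma flinear_sum phi d (z : 'I_d -> C) (f : 'I_d -> g -> C) h : flinear phi ->
  (forall u, h u = \sum_j z j * f j u) -> phi h = \sum_j z j * phi (f j).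
Proof.
move=> lphi; elim: d => [|d IH] in z f h *.
  rewrite big_ord0 => h0; rewrite (lphi 0 0 h h h) ?mul0r ?addr0 // => u.
  by rewrite h0 big_ord0 mul0r addr0.
move=> hE; rewrite big_ord_recl -(IH (fun j => z (lift ord0 j)) (fun j => f (lift ord0 j))
  (fun u => \sum_j z (lift ord0 j) * f (lift ord0 j) u)) // -[X in _ + X]mul1r.
by apply: lphi => u; rewrite hE big_ord_recl mul1r.
Qed.

Lemma top_pairing_linear1 f2 f3 : flinear (fun f => top_pairing f f2 f3).
Proof.
move=> s t f f' h E; rewrite /top_pairing /wedge_value !mulr_sumr -big_split.
apply: eq_bigr => l _; rewrite (fdet4_lin1 e (pq_rows_size a b l) f2 f3 xiC E) mulrDr.
by congr (_ + _); exact: mulrCA.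
Qed.

Lemma top_pairing_linear2 f1 f3 : flinear (fun f => top_pairing f1 f f3).
Proof.
move=> s t f f' h E; rewrite /top_pairing /wedge_value !mulr_sumr -big_split.
apply: eq_bigr => l _; rewrite (fdet4_lin2 e (pq_rows_size a b l) f1 f3 xiC E) mulrDr.
by congr (_ + _); exact: mulrCA.
Qed.

Lemma top_pairing_linear3 f1 f2 : flinear (fun f => top_pairing f1 f2 f).
Proof.
move=> s t f f' h E; rewrite /top_pairing /wedge_value !mulr_sumr -big_split.
apply: eq_bigr => l _; rewrite (fdet4_lin3 e (pq_rows_size a b l) f1 f2 xiC E) mulrDr.
by congr (_ + _); exact: mulrCA.
Qed.

Lemma top_pairing_swap12 f1 f2 f3 : top_pairing f1 f2 f3 = - top_pairing f2 f1 f3.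
Proof.
rewrite /top_pairing /wedge_value -sumrN; apply: eq_bigr => l _.
by rewrite (fdet4_swap12 e (pq_rows_size a b l)) mulrN.
Qed.

Lemma top_pairing_swap23 f1 f2 f3 : top_pairing f1 f2 f3 = - top_pairing f1 f3 f2.
Proof.
rewrite /top_pairing /wedge_value -sumrN; apply: eq_bigr => l _.
by rewrite (fdet4_swap23 e (pq_rows_size a b l)) mulrN.
Qed.

Lemma top_pairing_alt12 f f3 : top_pairing f f f3 = 0.
Proof.
rewrite /top_pairing /wedge_value big1 // => l _.
by rewrite (fdet4_alt12 e (pq_rows_size a b l)) mulr0.
Qed.

Lemma top_pairing_alt13 f f2 : top_pairing f f2 f = 0.
Proof. by rewrite top_pairing_swap23 top_pairing_alt12 oppr0. Qed.

Lemma top_pairing_alt23 f f1 : top_pairing f1 f f = 0.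
Proof. by rewrite top_pairing_swap12 top_pairing_alt13 oppr0. Qed.

(** The derivative along ad X of the full product is zero; so are the terms
    where it hits Omega, by closedness, and xi, since ad X maps into the
    ideal. *)
Lemma top_pairing_invariant f1 f2 f3 : rlin f1 -> rlin f2 -> rlin f3 ->
  top_pairing (fun u => f1 (L X u)) f2 f3 + top_pairing f1 (fun u => f2 (L X u)) f3
    + top_pairing f1 f2 (fun u => f3 (L X u)) = 0.
Proof.
move=> l1 l2 l3; pose F := [:: f1; f2; f3; xiC].
have lF : all_rlin F.
  have rlin_0 : @rlin R g (fun=> 0) by move=> r u v; rewrite mulr0 addr0.
  move=> [|[|[|[|i]]]] //=; first exact: rlin_xiC frame.
  by rewrite nth_nil.
pose G (j : nat) := wedge_value e c A (set_nth (fun=> 0) F j (along_ad L X F j)).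
have G3 : G 3 = 0.
  rewrite /G /wedge_value big1 // => t _.
  rewrite (@fdet_row0 _ _ _ _ _ (rshift k (ord_max : 'I_4))) ?mulr0 // => j.
  rewrite nth_cat pq_rows_size /= ltnNge leq_addr /= addKn /= /along_ad /= /xiC.
  by rewrite (frame_ideal frame) rmorph0.
have E : \sum_(j < 4) G j = 0.
  exact: (wedge_value_invariant frame (pq_rows_rlin a10 b10) (pq_rows_size a b)
    A_closed (i0 := ord_max)
    (erefl 4 : size F = 4) lF (fun u => erefl)).
by rewrite sum_ord4 G3 addr0 in E.
Qed.

Lemma dim_frame : (k + 4 = n + n)%N.
Proof. by rewrite !(addnS, addSn) addn0. Qed.

Lemma top_pairing_alpha f : \sum_t c t * fdet (A t ++ [:: alpha; f; conjf alpha; conjf f]) e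
  = - ('i%C *+ 2) * top_pairing f (conjf f) etaC.
Proof.
rewrite /top_pairing /wedge_value mulr_sumr; apply: eq_bigr => t _.
rewrite (@fdet4_split _ _ _ e (A t) (pq_rows_size a b t) 'i%C xiC f etaC (conjf f)) //.
  by rewrite mulrCA.
by move=> u; rewrite conjf_alpha.
Qed.

Lemma fdet_alpha f u : alpha u * f X = 0 ->
  fdet [:: alpha; f] (pair_fun X u) = f u.
Proof.
move=> auX; rewrite fdet2 /pair_fun /= (alpha_X frame) mul1r.
by rewrite auX subr0.
Qed.

(** Transversality against alpha /\ f.  The scalar kappa absorbs the value of a
    reference volume form on the frame and the constant of [fdet4_split]. *)
Lemma top_pairing_positive : (2 < \dim {:g})%N ->
  exists2 a0 : 'I_n -> g -> C, basis10 J a0 & exists2 kappa : C, kappa != 0 &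
  forall f u, form10 J f -> f X = 0 -> f u != 0 -> 0 < top_pairing f (conjf f) etaC / kappa.
Proof.
move=> dim2; have fa := form10_alpha frame JJ.
have eta_linr r u v : eta (r *: u + v) = r * eta u + eta v by exact: eta_lin frame _ _ _.
have [u0 [u00 xu0 eu0]] := exists_kernel2 (frame_lin frame) eta_linr dim2.
have [f0 ff0 fu0] := exists_form10_neq0 JJ u00.
have au0 : alpha u0 = 0 by rewrite /alpha /xiC /etaC xu0 eu0 rmorph0 !mulr0 addr0.
have [|r0 r0_gt0 [a0 ba0 _]] := A_pos (x0 := pair_fun X u0) fa ff0.
  by rewrite fdet_alpha // au0 mul0r.
exists a0 => //; have D0 := fdet_basis_neq0 dim_frame ba0 (frame_span frame).
have i2 : - ('i%C *+ 2) != 0 :> C by rewrite oppr_eq0 mulrn_eq0 /= Ci_neq0.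
have K0 : 'i%C ^+ (n ^ 2) * fdet (codom a0 ++ map conjf (codom a0)) e != 0.
  by rewrite mulf_neq0 // expf_neq0 // Ci_neq0.
exists ('i%C ^+ (n ^ 2) * fdet (codom a0 ++ map conjf (codom a0)) e / - ('i%C *+ 2)).
  by rewrite mulf_neq0 // invr_eq0.
move=> f u ff fX fu.
have [|r r_gt0 [a1 ba1]] := A_pos (x0 := pair_fun X u) fa ff.
  by rewrite fdet_alpha // fX mulr0.
rewrite top_pairing_alpha; have [S uS ES] := basis10_trans ba0 ba1.
rewrite (fdet_conj_change e dim_frame ES) => ET.
rewrite invf_div mulrA [top_pairing _ _ _ * _]mulrC ET.
rewrite ['i%C ^+ _ * (_ * _ * _)]mulrCA [r%:C%C * _]mulrA mulfK //.
have dS : \det S != 0 by rewrite -unitfE -unitmxE.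
apply: mulr_gt0; first by rewrite ltcR.
by rewrite lt_def mul_conjC_ge0 mulf_neq0 // conjc_eq0.
Qed.

(** By bidegree: all the rows lie in the span of the n basis (1,0)-forms, the
    n - 2 conjugate rows of Omega and conj alpha, that is of 2n - 1
    functionals. *)
Lemma top_pairing_form10 (a0 : 'I_n -> g -> C) f1 f2 : basis10 J a0 ->
  form10 J f1 -> form10 J f2 -> top_pairing f1 f2 etaC = 0.
Proof.
move=> ba0 ff1 ff2; rewrite /top_pairing /wedge_value big1 // => t _.
pose s := codom a0 ++ (map conjf (codom (b t)) ++ [:: conjf alpha]).
have span10 f : form10 J f -> inspan s f.
  move=> ff; apply: inspan_catl; have [l El] := basis10_coord ba0 (fun _ : 'I_1 => ff).
  exists (fun j => l 0 (inord j)) => u; rewrite (El 0) size_codom_ord.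
  by apply: eq_bigr => j _; rewrite nth_codom_ord inord_val.
have span_conj j : inspan s (nth (fun=> 0) (map conjf (codom (b t))) j).
  by apply/inspan_catr/inspan_catl/inspan_nth.
have span_a : inspan s alpha by apply/span10/(form10_alpha frame JJ).
have span_ac : inspan s (conjf alpha).
  by apply/inspan_catr/inspan_catr; exact: (inspan_nth [:: conjf alpha] 0).
have i0 := Ci_neq0 R; have n2 : (2%:R : C) != 0 by rewrite pnatr_eq0.
rewrite (@fdet_inspan _ _ _ s) ?mulr0 //.
  by rewrite !size_cat size_codom_ord size_map size_codom_ord /= !(addnS, addSn, addn0).
apply: all_inspan_cat.
  apply: all_inspan_cat; last exact: span_conj.
  move=> j; case: (ltnP j k0.+1) => lt_j.
    by rewrite -[j]/(val (Ordinal lt_j)) nth_codom_ord; apply: span10.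
  by rewrite nth_default ?size_codom_ord //; have := all_inspan_nil s j; rewrite nth_nil.
apply: all_inspan_cons; first exact: span10.
apply: all_inspan_cons; first exact: span10.
apply: all_inspan_cons.
  apply: (inspan_lin (a := (2%:R * 'i%C)^-1) (b := - (2%:R * 'i%C)^-1) span_a span_ac) => u.
  by rewrite conjf_alpha /alpha; apply: half_diff; rewrite ?mulf_neq0.
apply: all_inspan_cons; last exact: all_inspan_nil.
apply: (inspan_lin (a := 2%:R^-1) (b := 2%:R^-1) span_a span_ac) => u.
by rewrite conjf_alpha /alpha; apply: half_sum.
Qed.

Lemma conjf_sum d (z : 'I_d -> C) (f : 'I_d -> g -> C) h :
  (forall u, h u = \sum_j z j * f j u) ->
  forall u, conjf h u = \sum_j (z j)^*%C * conjf (f j) u.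
Proof.
move=> hE u; rewrite /conjf hE conjc_sum; apply: eq_bigr => j _.
by rewrite conjcM.
Qed.

Lemma top_pairing_sesq d d' (z : 'I_d -> C) (z' : 'I_d' -> C) f f' h h' :
  (forall u, h u = \sum_j z j * f j u) -> (forall u, h' u = \sum_j z' j * f' j u) ->
  top_pairing h (conjf h') etaC =
  \sum_i \sum_j z i * (z' j)^*%C * top_pairing (f i) (conjf (f' j)) etaC.
Proof.
move=> hE hE'; rewrite (flinear_sum (@top_pairing_linear1 _ _) hE); apply: eq_bigr => i _.
rewrite (flinear_sum (@top_pairing_linear2 _ _) (conjf_sum hE')) mulr_sumr.
by apply: eq_bigr => j _; rewrite mulrA.
Qed.

Lemma conjf_etaC u : conjf etaC u = etaC u.
Proof. exact: conjc_real. Qed.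

Lemma conjf_form10_ad f y : form10 J f ->
  conjf f (L X y) = conjf f (reduced_ad L J xi X y)
                    + (f (L X (J X)))^*%C * etaC y.
Proof.
move=> ff; rewrite /conjf (form10_ad L xi X y ff).
transitivity ((f (reduced_ad L J xi X y))^*%C + (f (L X (J X)) * etaC y)^*%C).
  exact: (rmorphD (@conjc R)).
by rewrite conjcM -/(conjf etaC y) conjf_etaC.
Qed.

Local Notation weight := ((ad_weight L J xi X)%:C%C : C).

Lemma etaC_ad y : etaC (L X y) = weight * etaC y.
Proof. by rewrite /etaC (eta_ad frame JJ) rmorphM mulrC. Qed.

(** Invariance on (f1, conj f2, eta); the multiples of eta by which ad X and its
    reduced version differ drop out because eta already occurs. *)
Lemma top_pairing_skew f1 f2 : form10 J f1 -> form10 J f2 ->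
  top_pairing (fun u => f1 (reduced_ad L J xi X u)) (conjf f2) etaC
  + top_pairing f1 (conjf (fun u => f2 (reduced_ad L J xi X u))) etaC
  = - weight * top_pairing f1 (conjf f2) etaC.
Proof.
move=> ff1 ff2; have := top_pairing_invariant (form10_rlin ff1) (rlin_conjf (form10_rlin ff2))
  (rlin_etaC (J := J) frame).
rewrite (@top_pairing_linear1 (conjf f2) etaC 1 (f1 (L X (J X)))
  (fun u => f1 (reduced_ad L J xi X u)) etaC (fun u => f1 (L X u))); last first.
  by move=> u; rewrite mul1r (form10_ad L xi X u ff1).
rewrite (@top_pairing_linear2 f1 etaC 1 (f2 (L X (J X)))^*%C
  (conjf (fun u => f2 (reduced_ad L J xi X u))) etaC (fun u => conjf f2 (L X u))); last first.
  by move=> u; rewrite mul1r; apply: conjf_form10_ad.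
rewrite (@top_pairing_linear3 f1 (conjf f2) weight 0 etaC etaC
  (fun u => etaC (L X u))); last first.
  by move=> u; rewrite mul0r addr0 etaC_ad.
by rewrite top_pairing_alt13 top_pairing_alt23; apply: skew_combine.
Qed.

Lemma rlin_eq0 f : rlin f -> (forall j, f (e j) = 0) -> forall u, f u = 0.
Proof.
move=> lf fe u; have [r ->] := frame_span frame u; rewrite rlin_sum // big1 // => j _.
by rewrite rlinZ // fe mulr0.
Qed.

Lemma acons_free d f (gam : 'I_d -> g -> C) (z : 'rV[C]_d) : basis10 J (acons f gam) ->
  (forall u, \sum_j z 0 j * gam j u = 0) -> z = 0.
Proof.
move=> ba z0; pose r : 'rV[C]_(1 + d) := row_mx (0 : 'M_1) z.
have r0 : r 0 ord0 = 0 by rewrite (ord0_lshift d) row_mxEl mxE.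
have rS j : r 0 (lift ord0 j) = z 0 j by rewrite lift0_rshift row_mxEr.
have r_eq0 : r = 0.
  apply: (basis10_free ba) => u; rewrite big_ord_recl acons0 r0 mul0r add0r.
  by rewrite -[RHS](z0 u); apply: eq_bigr => j _; rewrite aconsS rS.
by apply/rowP => j; rewrite -rS r_eq0 !mxE.
Qed.

(** P is the matrix of the reduced ad X and H that of the pairing, both on the
    (1,0)-forms vanishing at X. *)
Lemma diagonal_frame : (2 < \dim {:g})%N ->
  exists gam : 'I_q -> g -> C, exists d : 'I_q -> C, exists kappa : C,
  [/\ kappa != 0, basis10 J (acons alpha gam), forall i, gam i X = 0,
      forall i y, gam i (reduced_ad L J xi X y) = d i * gam i y &
      forall i j, top_pairing (gam i) (conjf (gam j)) etaC = kappa * (i == j)%:R].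
Proof.
move=> dim2; have fa := form10_alpha frame JJ.
have [a0 ba0 [kappa kappa0 Tpos]] := top_pairing_positive dim2.
have [g0 bg0 g0X] := exists_acons_basis ba0 fa (alpha_X (J := J) frame).
have fg0 i : form10 J (g0 i) by rewrite -(aconsS alpha g0); exact: bg0.1.
have [S0 ES0] := basis10_coord bg0 (fun i => form10_reduced frame JJ (fg0 i)).
pose P : 'M[C]_q := \matrix_(i, j) S0 i (lift ord0 j).
have PE i y : g0 i (reduced_ad L J xi X y) = \sum_j P i j * g0 j y.
  have S00 : S0 i ord0 = 0.
    have := ES0 i X; rewrite (reduced_ad_X frame) (rlin0 (form10_rlin (fg0 i))).
    rewrite big_ord_recl acons0 (alpha_X frame) mulr1 big1 ?addr0 // => j _.
    by rewrite aconsS g0X mulr0.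
  rewrite ES0 big_ord_recl S00 mul0r add0r; apply: eq_bigr => j _.
  by rewrite mxE aconsS.
clearbody P.
pose H : 'M[C]_q := \matrix_(i, j) (top_pairing (g0 i) (conjf (g0 j)) etaC / kappa).
have TE d1 (M : 'M[C]_(d1, q)) h : (forall i u, h i u = \sum_j M i j * g0 j u) ->
    forall i j, top_pairing (h i) (conjf (h j)) etaC = kappa * (M *m H *m M^t*) i j.
  move=> hE i j; rewrite (top_pairing_sesq (hE i) (hE j)) mxE mulr_sumr exchange_big.
  apply: eq_bigr => l _; rewrite !mxE mulr_suml mulr_sumr; apply: eq_bigr => l' _.
  by rewrite mxE; apply: sesq_entry.
have Hpos (z : 'rV[C]_q) : z != 0 -> 0 < (z *m H *m z^t*) 0 0.
  move=> z0; pose h (i : 'I_1) u := \sum_j z i j * g0 j u.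
  have fh : form10 J (h 0) by exact: (form10_lincomb (fun j => z 0 j) fg0).
  have [j hj] : exists j, h 0 (e j) != 0.
    apply/existsP; apply: contraNT z0; rewrite negb_exists => /forallP he.
    apply/eqP/(acons_free bg0)/(rlin_eq0 (form10_rlin fh)) => j.
    by move: (he j); rewrite negbK => /eqP.
  have hX : h 0 X = 0 by rewrite /h big1 // => l _; rewrite g0X mulr0.
  by have := Tpos _ _ fh hX hj; rewrite (TE _ z) // mulrC mulrA mulVf // mul1r.
have skewP : P *m H + H *m P^t* = - weight *: H.
  apply/matrixP => i j; have skew_ij := top_pairing_skew (fg0 i) (fg0 j).
  have EP : (P *m H) i j
      = top_pairing (fun u => g0 i (reduced_ad L J xi X u)) (conjf (g0 j)) etaC / kappa.
    rewrite (flinear_sum (@top_pairing_linear1 _ _) (PE i)) mulr_suml mxE.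
    by apply: eq_bigr => l _; rewrite mxE mulrA.
  have EPt : (H *m P^t*) i j
      = top_pairing (g0 i) (conjf (fun u => g0 j (reduced_ad L J xi X u))) etaC / kappa.
    rewrite (flinear_sum (@top_pairing_linear2 _ _) (conjf_sum (PE j))) mulr_suml mxE.
    by apply: eq_bigr => l _; rewrite !mxE mulrC mulrA.
  by rewrite mxE EP EPt -mulrDl skew_ij [RHS]mxE [in RHS]mxE mulrA.
have [S [d [uS SP SH]]] := skew_eigenbasis Hpos skewP.
pose gam i u := \sum_j S i j * g0 j u.
exists gam, (fun i => d 0 i), kappa; split=> //.
- apply: (acons_change (z := fun=> 0) uS bg0) => i u.
  by rewrite mul0r addr0.
- by move=> i; rewrite /gam big1 // => j _; rewrite g0X mulr0.
- move=> i y; rewrite /gam; under eq_bigr => j _ do rewrite PE.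
  rewrite -sum_mulmx SP mulr_sumr; apply: eq_bigr => j _.
  by rewrite mul_diag_mx mxE mulrA.
- by move=> i j; rewrite (TE _ S) // SH mxE.
Qed.

(** The functionals are eigenvectors of the transpose of ad X modulo the j0-th
    one, so the qs are the diagonal entries of a triangular matrix of ad X. *)
Lemma trace_eigenlist s (j0 : 'I_(k + 4)) (qs z : 'I_(k + 4) -> C) :
  size s = (k + 4)%N -> all_rlin s -> fdet s e != 0 -> z j0 = 0 ->
  (forall (i : 'I_(k + 4)) u, nth (fun=> 0) s i (L X u)
     = qs i * nth (fun=> 0) s i u + z i * nth (fun=> 0) s j0 u) ->
  \sum_i qs i = 0.
Proof.
move=> sz_s ls s0 zj0 E; have := fdet_along_ad frame sz_s ls.
rewrite (fdet_set_nth (along_ad L X s)) //.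
pose Q : 'M[C]_(k + 4) := \matrix_(i, j) (qs i *+ (i == j) + z i *+ (j == j0)).
have -> : \matrix_(i, j) along_ad L X s i (e j) = Q *m fmx s e :> 'M_(k + 4).
  apply/matrixP => i j; rewrite !mxE /along_ad E.
  under eq_bigr => l _ do rewrite !mxE mulrDl.
  rewrite big_split (bigD1 i) //= eqxx big1 ?addr0 => [|l /negbTE li]; last first.
    by rewrite eq_sym li mul0r.
  rewrite (bigD1 j0) //= eqxx big1 ?addr0 // => l /negbTE ->.
  by rewrite mul0r.
rewrite -mulmxA mul_mx_adj mul_mx_scalar mxtraceZ => /eqP.
rewrite mulf_eq0 (negbTE s0) /= => /eqP trQ; rewrite -[RHS]trQ.
apply: eq_bigr => i _; rewrite mxE eqxx; case: eqP => [->|_].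
  by rewrite zj0 mul0rn addr0.
by rewrite addr0.
Qed.

Lemma fdet_xi_eta r : fdet (alpha :: conjf alpha :: r) e
  = - ('i%C *+ 2) * fdet (xiC :: etaC :: r) e.
Proof.
have alt f : fdet (f :: f :: r) e = 0.
  by apply: (@fdet_alt _ _ _ [::] [::]); rewrite addn4.
have lin1 f : fdet (alpha :: f :: r) e
    = 1 * fdet (xiC :: f :: r) e + 'i%C * fdet (etaC :: f :: r) e.
  by apply: (@fdet_lin _ _ _ [::]) => //; rewrite addn4.
have -> : fdet (alpha :: conjf alpha :: r) e
    = 1 * fdet (alpha :: xiC :: r) e + - 'i%C * fdet (alpha :: etaC :: r) e.
  apply: (@fdet_lin _ _ _ [:: alpha]); first by rewrite addn4.
  by move=> u; rewrite conjf_alpha.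
rewrite !lin1 !alt (@fdet_swap _ _ _ [::] _ _ etaC) ?addn4 //.
rewrite !mulr0 !mul1r add0r addr0 mulrN mulNr -opprD -mulrDl -mulr2n.
by rewrite mulNr.
Qed.

(** Computes the trace of ad X in the dual basis xi, eta, gamma_i, conj gamma_i,
    where it has the eigenvalues 0, a, d_i and conj d_i. *)
Lemma trace_weights (gam : 'I_q -> g -> C) (d : 'I_q -> C) :
  basis10 J (acons alpha gam) ->
  (forall i y, gam i (reduced_ad L J xi X y) = d i * gam i y) ->
  weight + \sum_i (d i + (d i)^*%C) = 0.
Proof.
move=> bg Egam; have fg i : form10 J (gam i) by rewrite -(aconsS alpha gam); exact: bg.1.
pose s := [:: xiC; etaC] ++ (codom gam ++ map conjf (codom gam)).
pose w := [:: 0; weight] ++ (codom d ++ map (@conjc R) (codom d)).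
have sz_cg : size (map conjf (codom gam)) = q by rewrite size_map size_codom_ord.
have sz_d : size (codom d) = q by rewrite size_codom card_ord.
have sz_cd : size (map (@conjc R) (codom d)) = q by rewrite size_map.
have sz_s : size s = (k + 4)%N.
  by rewrite !size_cat sz_cg size_codom_ord /= !(addnS, addSn, addn0).
have sz_w : size w = (k + 4)%N.
  by rewrite !size_cat sz_d sz_cd /= !(addnS, addSn, addn0).
have nth_s (P : nat -> (g -> C) -> C -> Prop) : P 0%N xiC 0 -> P 1%N etaC weight ->
    (forall l : 'I_q, P l.+2 (gam l) (d l)) ->
    (forall l : 'I_q, P (q + l).+2 (conjf (gam l)) (d l)^*%C) ->
    forall j, (j < k + 4)%N -> P j (nth (fun=> 0) s j) (nth 0 w j).
  move=> P0 P1 Pg Pc [|[|j]] //= lt_j; rewrite !nth_cat size_codom_ord sz_d.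
  case: ltnP => [lt_jq|le_qj].
    by have := Pg (Ordinal lt_jq); rewrite -(nth_codom_ord gam (fun=> 0)) -(nth_codom_ord d 0).
  have lt_jq : (j - q < q)%N.
    rewrite -sz_s !size_cat sz_cg size_codom_ord /= in lt_j.
    by rewrite ltn_subLR.
  rewrite -[(j - q)%N]/(nat_of_ord (Ordinal lt_jq)) !nth_map_codom.
  have Ej : (q + Ordinal lt_jq)%N = j by exact: subnKC le_qj.
  by have := Pc (Ordinal lt_jq); rewrite Ej.
have lin_s : all_rlin s.
  move=> j; case: (ltnP j (k + 4)) => lt_j; last first.
    by rewrite nth_default ?sz_s // => r u v; rewrite mulr0 addr0.
  apply: (nth_s (fun _ f _ => rlin f)) lt_j; first exact: rlin_xiC frame.
  - exact: rlin_etaC frame.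
  - by move=> l; apply: form10_rlin (fg l).
  - by move=> l; apply: rlin_conjf (form10_rlin (fg l)).
have eig (i : 'I_(k + 4)) : exists z, (i = 1%N :> nat -> z = 0) /\ forall u,
    nth (fun=> 0) s i (L X u) = nth 0 w i * nth (fun=> 0) s i u + z * etaC u.
  apply: (nth_s (fun j f t => exists z, (j = 1%N -> z = 0) /\
    forall u, f (L X u) = t * f u + z * etaC u)) (ltn_ord i).
  - exists 0; split=> // u; rewrite /xiC (frame_ideal frame) rmorph0.
    by rewrite !mul0r addr0.
  - by exists 0; split=> // u; rewrite etaC_ad mul0r addr0.
  - move=> l; exists (gam l (L X (J X))); split=> // u.
    by rewrite (form10_ad L xi X u (fg l)) Egam.
  - move=> l; exists (gam l (L X (J X)))^*%C; split=> // u.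
    by rewrite (conjf_form10_ad u (fg l)) /conjf Egam conjcM.
have [z Pz] := fin_all_exists eig.
have j0P : (1 < k + 4)%N by rewrite addn4.
have s0 : fdet s e != 0.
  have := fdet_basis_neq0 dim_frame bg (frame_span frame).
  apply: contraNneq => s0.
  have := @fdet_move _ _ _ (codom gam) (map conjf (codom gam)) e alpha (conjf alpha).
  rewrite fdet_xi_eta -[_ :: _ :: _]/s s0 mulr0 codom_acons size_codom_ord => E.
  have lt_q : (q.+1 < k + 4)%N.
    by rewrite addn4 !ltnS leqW // leq_addr.
  by have /eqP := E lt_q; rewrite eq_sym mulf_eq0 signr_eq0.
have := trace_eigenlist sz_s lin_s s0 ((Pz (Ordinal j0P)).1 erefl) (fun i => (Pz i).2).
move=> sum_w; rewrite -[RHS]sum_w.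
transitivity (\sum_(t <- w) t); last by rewrite (big_nth 0) big_mkord sz_w.
rewrite /w big_cat /= !big_cons big_nil add0r addr0; congr (_ + _).
by rewrite big_cat /= [X in _ + X]big_map !big_image big_split.
Qed.

(** * The corrected eigenforms *)

Section Diagonal.
Variables (gam : 'I_q -> g -> C) (d : 'I_q -> C) (kappa : C).
Hypothesis kappa0 : kappa != 0.
Hypothesis gam_basis : basis10 J (acons alpha gam).
Hypothesis gam_ad : forall i y, gam i (reduced_ad L J xi X y) = d i * gam i y.
Hypothesis gam_orth : forall i j,
  top_pairing (gam i) (conjf (gam j)) etaC = kappa * (i == j)%:R.

Lemma gam10 i : form10 J (gam i).
Proof. by rewrite -(aconsS alpha gam); exact: gam_basis.1. Qed.

Lemma weight_sum i : d i + (d i)^*%C = - weight.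
Proof.
have := top_pairing_skew (gam10 i) (gam10 i).
rewrite (@top_pairing_linear1 _ _ (d i) 0 (gam i) (gam i)); last first.
  by move=> u; rewrite mul0r addr0 gam_ad.
rewrite (@top_pairing_linear2 _ _ (d i)^*%C 0 (conjf (gam i)) (conjf (gam i))
  (conjf (fun u => gam i (reduced_ad L J xi X u)))); last first.
  by move=> u; rewrite mul0r addr0 /conjf gam_ad conjcM.
rewrite gam_orth eqxx mulr1 !mul0r !addr0 -mulrDl; exact: mulIf.
Qed.

(** The trace relation reads a = (n - 1) a, and n - 1 is not 1. *)
Lemma weight0 : weight = 0.
Proof.
have := trace_weights gam_basis gam_ad; under eq_bigr => i _ do rewrite weight_sum.
rewrite sumr_const card_ord mulNrn mulrS opprD addNKr => /eqP.
by rewrite oppr_eq0 mulrn_eq0 /= => /eqP.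
Qed.

Lemma d_imaginary i : d i + (d i)^*%C = 0.
Proof. by rewrite weight_sum weight0 oppr0. Qed.

Lemma gam_lie i u : gam i (L X u) = d i * gam i u + gam i (L X (J X)) * etaC u.
Proof. by rewrite (form10_ad L xi X u (gam10 i)) gam_ad. Qed.

(** In the invariance relation on (gamma_i, gamma_j, conj gamma_j) the terms
    without eta cancel since d_i = 0 and d_j is imaginary, and two of the three
    terms with eta vanish, by orthogonality and by bidegree. *)
Lemma gam_kernel i : d i = 0 -> gam i (L X (J X)) = 0.
Proof.
move=> di0; have [j ji] : exists j : 'I_q, j != i.
  by case: (eqVneq i ord0) => [->|i0]; [exists ord_max | exists ord0; rewrite eq_sym].
have lj := form10_rlin (gam10 j).
have := top_pairing_invariant (form10_rlin (gam10 i)) lj (rlin_conjf lj).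
rewrite (@top_pairing_linear1 (gam j) (conjf (gam j)) 0 (gam i (L X (J X))) (gam i) etaC
  (fun u => gam i (L X u))); last by move=> u; rewrite gam_lie di0.
rewrite (@top_pairing_linear2 (gam i) (conjf (gam j)) (d j) (gam j (L X (J X))) (gam j) etaC
  (fun u => gam j (L X u))); last exact: gam_lie.
rewrite (@top_pairing_linear3 (gam i) (gam j) (d j)^*%C (gam j (L X (J X)))^*%C
  (conjf (gam j)) etaC
  (fun u => conjf (gam j) (L X u))); last first.
  move=> u; rewrite (conjf_form10_ad u (gam10 j)); congr (_ + _).
  by rewrite /conjf gam_ad conjcM.
have -> : top_pairing etaC (gam j) (conjf (gam j)) = kappa.
  by rewrite top_pairing_swap12 top_pairing_swap23 opprK gam_orth eqxx mulr1.
have -> : top_pairing (gam i) etaC (conjf (gam j)) = 0.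
  by rewrite top_pairing_swap23 gam_orth eq_sym (negbTE ji) mulr0 oppr0.
have [a0 ba0] : exists a0, basis10 J (a0 : 'I_n -> g -> C) by exists (acons alpha gam).
rewrite (top_pairing_form10 ba0 (gam10 i) (gam10 j)) => E.
exact: (kernel_combine kappa0 (d_imaginary j) E).
Qed.

(** The correction z_i alpha is chosen to cancel the eta-term of gamma_i o ad X:
    one divides by i d_i if d_i <> 0, and the term is zero by [gam_kernel] if
    d_i = 0. *)
Lemma exists_kahler_form : exists w : kform g (1 + 1), p_kahler J L n 1 w.
Proof.
pose z i := if d i == 0 then 0 else gam i (L X (J X)) / ('i%C * d i).
have zE i : gam i (L X (J X)) = 'i%C * d i * z i.
  rewrite /z; case: eqP => [di0|/eqP di0]; first by rewrite gam_kernel ?mulr0.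
  by rewrite mulrC divfK // mulf_neq0 // Ci_neq0.
clearbody z; pose gam' i u := gam i u + z i * alpha u.
exists (kahler_form (acons alpha gam')).
apply: (@kahler_of_diagonal_basis _ _ _ _ _ _ (fun i => oapp d 0 (unlift ord0 i)) xi) => //.
- apply: (acons_change (S := 1%:M) (z := z) (unitmx1 _ _) gam_basis) => i u.
  by rewrite sum_1mx.
- move=> i; case: unliftP => [j|] _ /=; first exact: d_imaginary.
  by rewrite add0r; exact: conjc0E.
move=> i u v; rewrite (frame_bracket frame).
have lie_lin (f : g -> C) : rlin f ->
    f (xi u *: L X v - xi v *: L X u) = (xi u)%:C%C * f (L X v) - (xi v)%:C%C * f (L X u).
  by move=> lf; rewrite lf rlinN // rlinZ.
case: (unliftP ord0 i) => [j|] -> /=.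
  rewrite aconsS lie_lin; last first.
    move=> r u' v'; rewrite /gam' (form10_rlin (gam10 j)) (form10_rlin (form10_alpha frame JJ)).
    exact: lin_combine.
  rewrite /gam' (gam_lie j u) (gam_lie j v) !zE !(alpha_ad frame JJ) weight0 /alpha.
  exact: shear_combine.
rewrite acons0 lie_lin; last exact: form10_rlin (form10_alpha frame JJ).
by rewrite !(alpha_ad frame JJ) weight0 !(mul0r, mulr0) subrr.
Qed.

End Diagonal.

Lemma kahler_of_invariant_form : (2 < \dim {:g})%N ->
  exists w : kform g (1 + 1), p_kahler J L n 1 w.
Proof.
move=> dim2; have [gam [d [kappa [kappa0 bg _ Eg og]]]] := diagonal_frame dim2.
exact: exists_kahler_form kappa0 bg Eg og.
Qed.

End HermitianPairing.

Theorem theorem4p2 (R : realType) (g : vectType R) (L : lie_algebra g)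
    (J : 'End(g)) (n : nat)
    (dim_g : \dim {:g} = (2 * n)%N) (n_ge : (6 <= 2 * n)%N)
    (unimodular_g : unimodular L) (almost_abelian_g : almost_abelian L)
    (complex_J : complex_structure L J) :
  (exists w : kform g (n - 2 + (n - 2)), p_kahler J L n (n - 2) w) ->
  exists w : kform g (1 + 1), p_kahler J L n 1 w.
Proof.
case: n dim_g n_ge => [|[|[|k0]]] // dim_g _; rewrite -[(k0.+3 - 2)%N]/(k0.+1).
case=> w [_ [N [c [a [b [a10 b10 wE]]]]] _ tr_w dw].
have JJ := complex_J.1.
have wA y : w y = \sum_t c t * fdet (pq_rows a b t) y by rewrite wE pq_form_fdet.
have dim_m : ((k0 + k0.+1).+1 + 4)%N = \dim {:g}.
  by rewrite dim_g mul2n -addnn !(addnS, addSn, addn0).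
have [xi [X [e [B frame]]]] :=
  exists_adapted_frame dim_m unimodular_g almost_abelian_g complex_J.
apply: (kahler_of_invariant_form JJ frame a10 b10 (c := c)).
- exact: (closed_invariant (k' := k0 + k0.+1) frame (pq_rows_rlin a10 b10) wA dw).
- move=> f h x0 ff fh fh0.
  have [|r r0 [a0 ba0 E]] :=
    transverse_pair (p := k0.+1) (pq_rows_size a b) _ wA tr_w ff fh fh0.
    by rewrite subSS -addn2 addKn.
  by exists r => //; exists a0 => //; apply: E.
by rewrite dim_g mul2n -addnn !(addnS, addSn).
Qed.
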